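(* For $a>0$ and $c\in\mathbb{R}$, let $g_3(x)=\dfrac{(\Gamma(x+a))^{1/x}}{(x+a)^c}$ for $x\in(0,\infty)$. (1) (i) For $a\ge 2$: $g_3$ is strictly decreasing on $(0,\infty)$ if and only if $c\ge 1$. (ii) For $a=2$: $g_3$ is strictly increasing on $(0,\infty)$ if and only if $c\le \frac{\pi^2}{6}-1$. (iii) For $\frac{3+\sqrt{159}}{12}\le a<2$: there is a point $x_4\in(0,\infty)$, depending only on $a$ and satisfying $$x_4^2(x_4+a)\psi'(x_4+a)+(x_4+2a)\log\Gamma(x_4+a)=x_4(x_4+2a)\psi(x_4+a),$$ such that $g_3$ is strictly increasing on $(0,\infty)$ if and only if $c\le h_4(x_4)$, where $$h_4(x_4)=\frac{x_4(x_4+a)\psi(x_4+a)-(x_4+a)\log\Gamma(x_4+a)}{x_4^2}.$$ (2) $g_3$ is geometrically convex on $(0,\infty)$ if $c\le 0$ and either $\frac12\le a\le 1$ or $a\ge 2$. For $1<a<2$ there is a point $x_3\in(0,\infty)$, depending only on $a$ and satisfying $x_3^2\psi'(x_3+a)+\log\Gamma(x_3+a)=x_3\psi(x_3+a)$, such that $g_3$ is geometrically concave on $(0,x_3)$ if $c\ge 0$, and $g_3$ is geometrically convex on $(x_3,\infty)$ if $c\le 0$.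
   Context: $\Gamma$ is the gamma function on $(0,\infty)$, $\psi=\Gamma'/\Gamma$ is the digamma function and $\psi'$ its derivative. A continuous $f:I\to(0,\infty)$ on an interval $I\subset(0,\infty)$ is geometrically convex (concave) if $f(\sqrt{x_1x_2})\le(\ge)\sqrt{f(x_1)f(x_2)}$ for all $x_1,x_2\in I$. *)

(* Defs.v *)
From Stdlib Require Import Reals.
From Coquelicot Require Import Coquelicot.
Open Scope R_scope.

(* Euler's integral; only meaningful for 0 < x, where the integral, improper
   at both ends, converges. *)
Definition Gamma (x : R) : R :=
  RInt_gen (fun t : R => Rpower t (x - 1) * exp (- t))
           (at_right 0) (Rbar_locally p_infty).

Definition digamma (x : R) : R := Derive Gamma x / Gamma x.

Definition trigamma (x : R) : R := Derive digamma x.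

Definition g3 (a c x : R) : R :=
  Rpower (Gamma (x + a)) (1 / x) / Rpower (x + a) c.

Definition h4 (a x : R) : R :=
  (x * (x + a) * digamma (x + a) - (x + a) * ln (Gamma (x + a))) / x ^ 2.

Definition positive_half_line (x : R) : Prop := 0 < x.

Definition strictly_increasing_on (I : R -> Prop) (f : R -> R) : Prop :=
  forall x y : R, I x -> I y -> x < y -> f x < f y.

Definition strictly_decreasing_on (I : R -> Prop) (f : R -> R) : Prop :=
  forall x y : R, I x -> I y -> x < y -> f y < f x.

Definition positive_interval (I : R -> Prop) : Prop :=
  (forall x : R, I x -> 0 < x) /\
  (forall x y z : R, I x -> I y -> x <= z <= y -> I z).

(* A function I -> (0, oo) is represented by a total function on R, so the
   positivity and the (relative) continuity on I are part of the notion. *)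
Definition geometrically_convex_on (I : R -> Prop) (f : R -> R) : Prop :=
  positive_interval I /\
  continuous_on I f /\
  (forall x : R, I x -> 0 < f x) /\
  (forall x1 x2 : R, I x1 -> I x2 ->
     f (sqrt (x1 * x2)) <= sqrt (f x1 * f x2)).

Definition geometrically_concave_on (I : R -> Prop) (f : R -> R) : Prop :=
  positive_interval I /\
  continuous_on I f /\
  (forall x : R, I x -> 0 < f x) /\
  (forall x1 x2 : R, I x1 -> I x2 ->
     f (sqrt (x1 * x2)) >= sqrt (f x1 * f x2)).

(* Main.v *)
Require Import Defs.
From Stdlib Require Import Reals Lra Lia.
From Coquelicot Require Import Coquelicot.
Open Scope R_scope.

(** Write [y = x + a], [D x = x * digamma y - ln (Gamma y)] ([root_slope]) and
    [N x = x^2 y * trigamma y - (x + 2 a) * D x] ([h4_slope]).  The derivative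
    of [ln (g3 a c x)] is [(h4 a x - c) / y], where [h4 a x = y * D x / x^2], so
    [g3 a c] increases when [c] is a lower bound of [h4 a] attained at one point
    at most, and decreases when [c] is such an upper bound; conversely, if [g3 a c]
    is monotone then [c] bounds [h4 a] on the corresponding side.  Everything is
    thus a question about the range of [h4 a].

    The upper bound.  [D x] and [x^2 / y] have the derivatives
    [x * trigamma y] and [x * (1 / y + a / y^2)], and
    [1 / y <= trigamma y <= 1 / y + 1 / y^2].  If [a >= 2] then
    [D 0 = - ln (Gamma a) <= 0], and the upper estimate gives [h4 a < 1]
    ([h4_lt_1]); the lower estimate shows that no constant below [1] bounds
    [h4 a] from above ([one_le_h4_upper_bound]).

    The lower bound.  The derivative of [h4 a] is [N x / x^3], and for
    [a >= 13 / 10] the function [N] is strictly convex with [N'] unbounded,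
    because [N'' >= x / (10 y^2)] ([h4_slope''_lower]).  At the origin
    [N 0 = 2 a * ln (Gamma a)] and [N' 0 = ln (Gamma a)].  For [a = 2] both
    vanish, so [h4 2] increases from its limit at [0], which is
    [trigamma 2 = PI^2 / 6 - 1].  For [13 / 10 <= a < 2] the value [N 0] is
    negative, so [N] has exactly one zero, the minimum of [h4 a]
    ([h4_minimum]).

    Geometric convexity is convexity of [ln (g3 a c)] as a function of [ln x],
    that is, monotonicity of [D x / x - c * x / y].  The derivative of this
    quantity is [K x / x^2 - c * a / y^2] with [K x = x^2 * trigamma y - D x]
    ([elasticity_slope]).  For [a >= 1 / 2] the function [K] is nondecreasing,
    as [K' >= (a - 1 / 2) * x / y^2], and [K 0 = ln (Gamma a)].  This value is
    nonnegative unless [1 < a < 2], and in that case [K] is unbounded above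
    and has a zero.

    All estimates rest on [trigamma x = sum of 1 / (x + n)^2] and on the
    derivatives of this series ([hurwitz]), which are compared term by term
    with telescoping series.  To obtain this expansion from Euler's integral,
    the series is integrated twice to a convex solution of
    [f (x + 1) = f x + ln x]; the logarithm of the integral is another one, by
    integration by parts and Hoelder's inequality, and the Bohr-Mollerup theorem
    identifies the two.  The value [PI^2 / 6] comes from Matsuoka's proof of
    Euler's identity ([basel]). *)

(** * Elementary calculus *)

Lemma mean_value (f f' : R -> R) (a b : R) :
  a < b -> (forall t, a <= t <= b -> is_derive f t (f' t)) ->
  exists t, a < t < b /\ f b - f a = f' t * (b - a).
Proof.
  intros Hab Hf.
  destruct (MVT_cor2 f f' a b Hab) as [t [Ht1 Ht2]].
  - intros t Ht. apply is_derive_Reals, Hf, Ht.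
  - exists t. split; assumption.
Qed.

Lemma derive_pos_lt (f f' : R -> R) (a b : R) :
  a < b -> (forall t, a <= t <= b -> is_derive f t (f' t)) ->
  (forall t, a < t < b -> 0 < f' t) -> f a < f b.
Proof.
  intros Hab Hf Hpos.
  destruct (mean_value f f' a b Hab Hf) as [t [Ht E]].
  specialize (Hpos t Ht). nra.
Qed.

Lemma derive_nonneg_le (f f' : R -> R) (a b : R) :
  a <= b -> (forall t, a <= t <= b -> is_derive f t (f' t)) ->
  (forall t, a < t < b -> 0 <= f' t) -> f a <= f b.
Proof.
  intros [Hab | Hab] Hf Hpos; [ | rewrite Hab; lra].
  destruct (mean_value f f' a b Hab Hf) as [t [Ht E]].
  specialize (Hpos t Ht). nra.
Qed.

Lemma derive_zero_eq (f f' : R -> R) (a b : R) :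
  a <= b -> (forall t, a <= t <= b -> is_derive f t (f' t)) ->
  (forall t, a < t < b -> f' t = 0) -> f a = f b.
Proof.
  intros [Hab | Hab] Hf Hz; [ | now rewrite Hab].
  destruct (mean_value f f' a b Hab Hf) as [t [Ht E]].
  rewrite (Hz t Ht) in E. lra.
Qed.

Lemma is_derive_continuity_pt (f : R -> R) (x l : R) :
  is_derive f x l -> continuity_pt f x.
Proof.
  intros H. apply continuity_pt_filterlim.
  apply (ex_derive_continuous f x). now exists l.
Qed.

Lemma intermediate_zero (f f' : R -> R) (a b : R) :
  a < b -> (forall t, a <= t <= b -> is_derive f t (f' t)) ->
  f a < 0 -> 0 < f b -> exists z, a < z < b /\ f z = 0.
Proof.
  intros Hab Hf Ha Hb.
  destruct (Ranalysis5.IVT_interv f a b) as [z [Hz E]]; try assumption.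
  - intros t Ht. apply (is_derive_continuity_pt f t (f' t)), Hf, Ht.
  - exists z. split; [ | exact E].
    destruct Hz as [[H1 | H1] [H2 | H2]]; subst; lra.
Qed.

(** A function whose derivative stays above [k x / (x + a)^2] grows like
    [k ln x], hence exceeds every bound: [x / (x + a)^2] is the derivative of
    [ln (x + a) + a / (x + a)]. *)
Lemma log_growth_unbounded (f f' : R -> R) (a k B : R) :
  0 < a -> 0 < k -> (forall t, 0 <= t -> is_derive f t (f' t)) ->
  (forall t, 0 < t -> k * t / (t + a) ^ 2 <= f' t) ->
  exists X, 0 < X /\ forall x, X <= x -> B < f x.
Proof.
  intros Ha Hk Hf Hlow.
  (* [m = ln ((X + a) / a)]: the growth of [k ln (x + a)] up to [X] must exceed
     [B - f 0] and the bounded term [a / (x + a)] *)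
  set (m := Rmax 1 (2 + (B - f 0) / k)).
  assert (Hm1 : 1 <= m) by apply Rmax_l.
  assert (Hm2 : 2 + (B - f 0) / k <= m) by apply Rmax_r.
  assert (He : 1 + m <= exp m) by apply exp_ineq1_le.
  exists (a * exp m - a). split; [nra | ].
  intros x Hx.
  assert (Hx0 : 0 < x) by nra.
  assert (Hmono : f 0 - k * (ln (0 + a) + a / (0 + a))
                  <= f x - k * (ln (x + a) + a / (x + a))).
  { apply (derive_nonneg_le (fun t => f t - k * (ln (t + a) + a / (t + a)))
             (fun t => f' t - k * t / (t + a) ^ 2)); [lra | | ].
    - intros t Ht.
      apply (is_derive_minus f (fun t => k * (ln (t + a) + a / (t + a)))).
      + apply Hf; lra.
      + auto_derive; [repeat split; lra | field; lra].
    - intros t Ht. specialize (Hlow t). lra. }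
  assert (Hln : ln a + m <= ln (x + a)).
  { rewrite <- (ln_exp m), <- ln_mult by (try apply exp_pos; lra).
    assert (0 < exp m) by apply exp_pos.
    destruct (Rle_lt_or_eq_dec (a * exp m) (x + a)) as [H0 | H0]; [lra | | ].
    - left. apply ln_increasing; nra.
    - rewrite H0. lra. }
  replace (0 + a) with a in Hmono by ring.
  replace (a / a) with 1 in Hmono by (field; lra).
  assert (Hq : 0 < a / (x + a)) by (apply Rdiv_lt_0_compat; lra).
  assert (Hkm : (B - f 0) / k * k = B - f 0) by (field; lra).
  nra.
Qed.

Lemma linear_growth_pos (f f' : R -> R) (X d : R) :
  0 < d -> (forall t, X <= t -> is_derive f t (f' t)) ->
  (forall t, X <= t -> d <= f' t) -> exists x, X < x /\ 0 < f x.
Proof.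
  intros Hd Hf Hlow.
  assert (H0 : 0 <= Rabs (f X) / d).
  { apply Rmult_le_pos; [apply Rabs_pos | left; now apply Rinv_0_lt_compat]. }
  exists (X + Rabs (f X) / d + 1). split; [lra | ].
  destruct (mean_value f f' X (X + Rabs (f X) / d + 1)) as [t [Ht E]];
    [lra | intros; apply Hf; lra | ].
  assert (Hl := Hlow t ltac:(lra)).
  assert (E2 : Rabs (f X) / d * d = Rabs (f X)) by (field; lra).
  assert (Habs := Rle_abs (- f X)). rewrite Rabs_Ropp in Habs.
  nra.
Qed.

Lemma le_of_forall_right (F : R -> R) (v d : R) :
  continuous F 0 -> 0 < d -> (forall t, 0 < t < d -> F t <= v) -> F 0 <= v.
Proof.
  intros HF Hd Hle. apply Rnot_lt_le. intros Hlt.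
  assert (Hp : 0 < F 0 - v) by lra.
  destruct (proj1 (filterlim_locally F (F 0)) HF (mkposreal _ Hp))
    as [[e He] Hball].
  set (t := Rmin e d / 2).
  assert (Ht : 0 < t < Rmin e d).
  { assert (0 < Rmin e d) by (apply Rmin_pos; lra). unfold t; lra. }
  assert (He' := Rmin_l e d). assert (Hd' := Rmin_r e d).
  assert (Hb : ball 0 e t).
  { change (Rabs (t - 0) < e). rewrite Rabs_right; lra. }
  specialize (Hball t Hb). change (Rabs (F t - F 0) < F 0 - v) in Hball.
  apply Rabs_def2 in Hball. specialize (Hle t). lra.
Qed.

Lemma exp_nondecr (x y : R) : x <= y -> exp x <= exp y.
Proof.
  intros [H | H]; [left; now apply exp_increasing | right; now f_equal].
Qed.

Lemma ex_RInt_pos (f : R -> R) (a b : R) :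
  (forall t, 0 < t -> continuous f t) -> 0 < a -> 0 < b -> ex_RInt f a b.
Proof.
  intros Hf Ha Hb. apply (ex_RInt_continuous f). intros z Hz. apply Hf.
  assert (0 < Rmin a b) by now apply Rmin_pos. lra.
Qed.

Lemma is_derive_RInt_pos (f : R -> R) (a x : R) :
  (forall t, 0 < t -> continuous f t) -> 0 < a -> 0 < x ->
  is_derive (fun x => RInt f a x) x (f x).
Proof.
  intros Hf Ha Hx.
  apply (is_derive_RInt f (fun x => RInt f a x) a x); [ | now apply Hf].
  exists (mkposreal x Hx). intros y Hy.
  change (Rabs (y - x) < x) in Hy. apply Rabs_def2 in Hy.
  apply (RInt_correct f a y), ex_RInt_pos; [exact Hf | exact Ha | lra].
Qed.

(** * Series and their derivatives *)

Lemma is_series_telescope (u : nat -> R) :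
  is_lim_seq u 0 -> is_series (fun n => u n - u (S n)) (u O).
Proof.
  intros Hu.
  change (is_lim_seq (sum_n (fun n => u n - u (S n))) (u O)).
  apply (is_lim_seq_ext (fun n => u O - u (S n))).
  - induction n as [|n IH].
    + now rewrite sum_O.
    + rewrite sum_Sn, <- IH. change plus with Rplus. simpl. ring.
  - replace (Finite (u O)) with (Finite (u O - 0)) by (f_equal; ring).
    apply is_lim_seq_minus'; [apply is_lim_seq_const | ].
    now apply is_lim_seq_incr_1 in Hu.
Qed.

Lemma ex_series_dominated (u v : nat -> R) :
  (forall n, Rabs (u n) <= v n) -> ex_series v -> ex_series u.
Proof. exact (@ex_series_le R_AbsRing R_CompleteNormedModule u v). Qed.

Lemma Series_nonneg (u : nat -> R) :
  ex_series u -> (forall n, 0 <= u n) -> 0 <= Series u.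
Proof.
  intros Hu Hp.
  rewrite <- (Rmult_0_l (Series u)), <- (Series_scal_l 0 u).
  apply Series_le; [ | exact Hu].
  intros n. specialize (Hp n). lra.
Qed.

(** Termwise comparison with a telescoping series; every rational bound on
    the polygamma functions is obtained in this way. *)
Lemma telescope_le_Series (u f : nat -> R) :
  is_lim_seq u 0 -> ex_series f -> (forall n, u n - u (S n) <= f n) ->
  u O <= Series f.
Proof.
  intros Hu Hf Hle.
  assert (Ht := is_series_telescope u Hu).
  assert (H0 : 0 <= Series (fun n => f n - (u n - u (S n)))).
  { apply Series_nonneg.
    - apply (ex_series_minus f); [exact Hf | now eexists; exact Ht].
    - intros n. specialize (Hle n). lra. }
  rewrite Series_minus in H0; [ | exact Hf | now eexists; exact Ht].
  rewrite (is_series_unique _ _ Ht) in H0. lra.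
Qed.

Lemma Series_le_telescope (u f : nat -> R) :
  is_lim_seq u 0 -> ex_series f -> (forall n, f n <= u n - u (S n)) ->
  Series f <= u O.
Proof.
  intros Hu Hf Hle.
  assert (H : - u O <= Series (fun n => - f n)).
  { apply (telescope_le_Series (fun n => - u n)).
    - replace (Finite 0) with (Rbar_opp (Finite 0)) by (simpl; f_equal; ring).
      now apply -> is_lim_seq_opp.
    - now apply (ex_series_opp f).
    - intros n. specialize (Hle n). lra. }
  rewrite Series_opp in H. lra.
Qed.

(** Taylor's formula of order two bounds the remainder of each term by
    [M n * (y - x)^2], and these bounds may be summed. *)
Lemma is_derive_Series (f f' f'' : nat -> R -> R) (M : nat -> R) (x r : R) :
  0 < r ->
  (forall n t, Rabs (t - x) < r -> is_derive (f n) t (f' n t)) ->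
  (forall n t, Rabs (t - x) < r -> is_derive (f' n) t (f'' n t)) ->
  (forall n t, Rabs (t - x) < r -> Rabs (f'' n t) <= M n) ->
  ex_series M ->
  (forall t, Rabs (t - x) < r -> ex_series (fun n => f n t)) ->
  ex_series (fun n => f' n x) ->
  is_derive (fun t => Series (fun n => f n t)) x (Series (fun n => f' n x)).
Proof.
  intros Hr Hf Hf' HM HMs Hfs Hf's.
  assert (Hx : Rabs (x - x) < r).
  { replace (x - x) with 0 by ring. now rewrite Rabs_R0. }
  assert (HM0 : forall n, 0 <= M n).
  { intros n. apply Rle_trans with (2 := HM n x Hx). apply Rabs_pos. }
  assert (Hlip : forall n t, Rabs (t - x) < r ->
            Rabs (f' n t - f' n x) <= M n * Rabs (t - x)).
  { intros n t Ht.
    destruct (MVT_gen (f' n) x t (f'' n)) as [c [Hc E]].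
    - intros s Hs. apply Hf'. revert Hs Ht.
      unfold Rmin, Rmax, Rabs; repeat (destruct Rcase_abs || destruct Rle_dec); lra.
    - intros s Hs. apply (is_derive_continuity_pt _ _ (f'' n s)), Hf'. revert Hs Ht.
      unfold Rmin, Rmax, Rabs; repeat (destruct Rcase_abs || destruct Rle_dec); lra.
    - rewrite E, Rabs_mult. apply Rmult_le_compat_r; [apply Rabs_pos | ].
      apply HM. revert Hc Ht.
      unfold Rmin, Rmax, Rabs; repeat (destruct Rcase_abs || destruct Rle_dec); lra. }
  assert (Hrem : forall n t, Rabs (t - x) < r ->
            Rabs (f n t - f n x - (t - x) * f' n x) <= M n * Rabs (t - x) ^ 2).
  { intros n t Ht.
    destruct (MVT_gen (f n) x t (f' n)) as [c [Hc E]].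
    - intros s Hs. apply Hf. revert Hs Ht.
      unfold Rmin, Rmax, Rabs; repeat (destruct Rcase_abs || destruct Rle_dec); lra.
    - intros s Hs. apply (is_derive_continuity_pt _ _ (f' n s)), Hf. revert Hs Ht.
      unfold Rmin, Rmax, Rabs; repeat (destruct Rcase_abs || destruct Rle_dec); lra.
    - rewrite E.
      replace (f' n c * (t - x) - (t - x) * f' n x)
        with ((f' n c - f' n x) * (t - x)) by ring.
      rewrite Rabs_mult. simpl. rewrite Rmult_1_r, <- Rmult_assoc.
      apply Rmult_le_compat_r; [apply Rabs_pos | ].
      assert (Hcx : Rabs (c - x) <= Rabs (t - x)).
      { revert Hc. unfold Rmin, Rmax, Rabs;
        repeat (destruct Rcase_abs || destruct Rle_dec); lra. }
      apply Rle_trans with (1 := Hlip n c ltac:(lra)).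
      now apply Rmult_le_compat_l. }
  set (C := Series M).
  assert (HC : 0 <= C) by now apply Series_nonneg.
  assert (Hsum : forall t, Rabs (t - x) < r ->
     Rabs (Series (fun n => f n t) - Series (fun n => f n x)
           - (t - x) * Series (fun n => f' n x)) <= C * Rabs (t - x) ^ 2).
  { intros t Ht.
    rewrite <- Series_minus, <- Series_scal_l, <- Series_minus; auto.
    - unfold C. rewrite <- Series_scal_r.
      apply Rle_trans with (Series (fun n => Rabs (f n t - f n x - (t - x) * f' n x))).
      + apply Series_Rabs.
        apply (ex_series_dominated _ (fun n => M n * Rabs (t - x) ^ 2)).
        * intros n. rewrite Rabs_Rabsolu. apply Hrem, Ht.
        * now apply ex_series_scal_r.
      + apply Series_le; [ | now apply ex_series_scal_r].
        intros n. split; [apply Rabs_pos | apply Hrem, Ht].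
    - apply (ex_series_minus (fun n => f n t)); auto.
    - apply (@ex_series_scal_l R_AbsRing R_NormedModule (t - x) (fun n => f' n x)); auto. }
  apply is_derive_Reals. intros eps Heps.
  assert (Hd : 0 < Rmin r (eps / (C + 1))).
  { apply Rmin_pos; [exact Hr | apply Rdiv_lt_0_compat; lra]. }
  exists (mkposreal _ Hd). intros h Hh Hhd. simpl in Hhd.
  assert (H1 := Rmin_l r (eps / (C + 1))). assert (H2 := Rmin_r r (eps / (C + 1))).
  specialize (Hsum (x + h)). replace (x + h - x) with h in Hsum by ring.
  specialize (Hsum ltac:(lra)).
  assert (Hah : 0 < Rabs h) by now apply Rabs_pos_lt.
  match goal with |- Rabs ?e < eps =>
    replace e with ((Series (fun n => f n (x + h)) - Series (fun n => f n x)
           - h * Series (fun n => f' n x)) / h) by (field; exact Hh) end.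
  unfold Rdiv. rewrite Rabs_mult, Rabs_inv.
  apply Rle_lt_trans with (C * Rabs h).
  - apply Rmult_le_reg_r with (Rabs h); [exact Hah | ].
    rewrite Rmult_assoc, Rinv_l by lra. lra.
  - apply Rle_lt_trans with ((C + 1) * Rabs h); [nra | ].
    apply Rmult_lt_reg_r with (/ (C + 1)); [apply Rinv_0_lt_compat; lra | ].
    replace ((C + 1) * Rabs h * / (C + 1)) with (Rabs h) by (field; lra).
    unfold Rdiv in H2. lra.
Qed.

(** * The Hurwitz zeta function at integers *)

Definition hurwitz (k : nat) (x : R) : R :=
  Series (fun n => / (x + INR n) ^ k).

Lemma shift_pos (x : R) (n : nat) : 0 < x -> 0 < x + INR n.
Proof. intros Hx. assert (H := pos_INR n). lra. Qed.

Lemma is_lim_seq_inv_shift (x : R) :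
  0 < x -> is_lim_seq (fun n => / (x + INR n)) 0.
Proof.
  intros Hx.
  replace (Finite 0) with (Rbar_inv p_infty) by reflexivity.
  apply is_lim_seq_inv; [ | discriminate].
  eapply is_lim_seq_plus;
    [apply is_lim_seq_const | apply is_lim_seq_INR | reflexivity].
Qed.

Lemma is_lim_seq_poly_inv_shift (p : R -> R) (x : R) :
  0 < x -> ex_derive p 0 -> p 0 = 0 ->
  is_lim_seq (fun n => p (/ (x + INR n))) 0.
Proof.
  intros Hx Hp H0.
  rewrite <- H0.
  apply (is_lim_seq_continuous p _ 0); [ | now apply is_lim_seq_inv_shift].
  now apply continuity_pt_filterlim, (ex_derive_continuous p 0).
Qed.

Lemma ex_series_inv_square (x : R) :
  0 < x -> ex_series (fun n => / (x + INR n) ^ 2).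
Proof.
  intros Hx.
  apply (ex_series_dominated _
    (fun n => (1 + / x) * (/ (x + INR n) - / (x + INR (S n))))).
  - intros n. assert (Hn := pos_INR n). rewrite S_INR.
    rewrite Rabs_right by (apply Rle_ge; left; apply Rinv_0_lt_compat, pow_lt; lra).
    apply Rminus_le_0.
    replace (_ - _) with (INR n / (x * (x + INR n) ^ 2 * (x + (INR n + 1))))
      by (field; repeat split; lra).
    apply Rmult_le_pos; [exact Hn | left; apply Rinv_0_lt_compat].
    repeat apply Rmult_lt_0_compat; lra.
  - apply (@ex_series_scal_l R_AbsRing R_NormedModule (1 + / x)
             (fun n => / (x + INR n) - / (x + INR (S n)))).
    eexists. apply (is_series_telescope (fun n => / (x + INR n))).
    now apply is_lim_seq_inv_shift.
Qed.

Lemma ex_series_hurwitz (k : nat) (x : R) :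
  0 < x -> (2 <= k)%nat -> ex_series (fun n => / (x + INR n) ^ k).
Proof.
  intros Hx Hk. replace k with (k - 2 + 2)%nat by lia.
  generalize (k - 2)%nat. clear k Hk. intros k.
  apply (ex_series_dominated _ (fun n => / x ^ k * / (x + INR n) ^ 2)).
  - intros n. assert (Hn := pos_INR n).
    assert (Hp : 0 < (x + INR n) ^ k) by (apply pow_lt; lra).
    rewrite Rabs_right by (apply Rle_ge; left; apply Rinv_0_lt_compat, pow_lt; lra).
    rewrite pow_add, Rinv_mult.
    apply Rmult_le_compat_r.
    + left; apply Rinv_0_lt_compat, pow_lt; lra.
    + apply Rinv_le_contravar; [now apply pow_lt | ].
      apply pow_incr. lra.
  - apply (@ex_series_scal_l R_AbsRing R_NormedModule (/ x ^ k)
             (fun n => / (x + INR n) ^ 2)).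
    now apply ex_series_inv_square.
Qed.

Lemma hurwitz_pos (k : nat) (x : R) : 0 < x -> (2 <= k)%nat -> 0 < hurwitz k x.
Proof.
  intros Hx Hk. unfold hurwitz.
  rewrite Series_incr_1 by now apply ex_series_hurwitz.
  apply Rplus_lt_le_0_compat.
  - apply Rinv_0_lt_compat, pow_lt. simpl. lra.
  - apply Series_nonneg.
    + apply -> (ex_series_incr_1 (fun n => / (x + INR n) ^ k)).
      now apply ex_series_hurwitz.
    + intros n. left. now apply Rinv_0_lt_compat, pow_lt, shift_pos.
Qed.

Lemma is_derive_inv_shift_pow (k n : nat) (t : R) :
  0 < t + INR n ->
  is_derive (fun t => / (t + INR n) ^ S k) t (- INR (S k) * / (t + INR n) ^ S (S k)).
Proof.
  intros Ht. auto_derive.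
  - apply (pow_nonzero _ (S k)). lra.
  - change (pred (S k)) with k. simpl pow.
    assert ((t + INR n) ^ k <> 0) by (apply pow_nonzero; lra).
    change (match k with O => 1 | S _ => INR k + 1 end) with (INR (S k)).
    field. split; lra.
Qed.

Lemma half_ball_lower (x t : R) : 0 < x -> Rabs (t - x) < x / 2 -> x / 2 < t.
Proof. intros Hx Ht. apply Rabs_def2 in Ht. lra. Qed.

Lemma inv_shift_pow_le (k n : nat) (u t : R) :
  0 < u -> u <= t -> / (t + INR n) ^ k <= / (u + INR n) ^ k.
Proof.
  intros Hu Ht. assert (Hn := pos_INR n).
  apply Rinv_le_contravar; [apply pow_lt; lra | apply pow_incr; lra].
Qed.

Lemma is_derive_hurwitz (k : nat) (x : R) :
  0 < x -> (2 <= k)%nat ->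
  is_derive (hurwitz k) x (- INR k * hurwitz (S k) x).
Proof.
  intros Hx Hk. destruct k as [|k]; [lia | ].
  unfold hurwitz at 2. rewrite <- Series_scal_l. unfold hurwitz.
  apply (is_derive_Series (fun n t => / (t + INR n) ^ S k)
    (fun n t => - INR (S k) * / (t + INR n) ^ S (S k))
    (fun n t => - INR (S k) * (- INR (S (S k)) * / (t + INR n) ^ S (S (S k))))
    (fun n => INR (S k) * INR (S (S k)) * / (x / 2 + INR n) ^ S (S (S k)))
    x (x / 2)); [lra | | | | | | ].
  - intros n t Ht. apply half_ball_lower in Ht; [ | exact Hx].
    apply is_derive_inv_shift_pow, shift_pos. lra.
  - intros n t Ht. apply half_ball_lower in Ht; [ | exact Hx].
    apply is_derive_scal, is_derive_inv_shift_pow, shift_pos. lra.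
  - intros n t Ht. apply half_ball_lower in Ht; [ | exact Hx].
    assert (H1 := pos_INR (S k)). assert (H2 := pos_INR (S (S k))).
    assert (H3 : 0 < / (t + INR n) ^ S (S (S k))).
    { apply Rinv_0_lt_compat, pow_lt, shift_pos. lra. }
    replace (- INR (S k) * (- INR (S (S k)) * / (t + INR n) ^ S (S (S k))))
      with (INR (S k) * INR (S (S k)) * / (t + INR n) ^ S (S (S k))) by ring.
    assert (H4 : 0 <= INR (S k) * INR (S (S k))) by now apply Rmult_le_pos.
    rewrite Rabs_right by (apply Rle_ge, Rmult_le_pos; lra).
    apply Rmult_le_compat_l; [exact H4 | apply inv_shift_pow_le; lra].
  - apply (@ex_series_scal_l R_AbsRing R_NormedModule (INR (S k) * INR (S (S k)))
      (fun n => / (x / 2 + INR n) ^ S (S (S k)))).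
    apply ex_series_hurwitz; [lra | lia].
  - intros t Ht. apply half_ball_lower in Ht; [ | exact Hx].
    apply ex_series_hurwitz; [lra | lia].
  - apply (@ex_series_scal_l R_AbsRing R_NormedModule (- INR (S k))
      (fun n => / (x + INR n) ^ S (S k))).
    apply ex_series_hurwitz; [lra | lia].
Qed.

Lemma hurwitz_decr (k : nat) (x y : R) :
  0 < x <= y -> (2 <= k)%nat -> hurwitz k y <= hurwitz k x.
Proof.
  intros Hxy Hk.
  apply Series_le; [ | apply ex_series_hurwitz; [lra | exact Hk]].
  intros n. split.
  - left. apply Rinv_0_lt_compat, pow_lt, shift_pos. lra.
  - apply inv_shift_pow_le; lra.
Qed.

Lemma hurwitz_shift (k : nat) (x : R) :
  0 < x -> (2 <= k)%nat -> hurwitz k (x + 1) = hurwitz k x - / x ^ k.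
Proof.
  intros Hx Hk. unfold hurwitz.
  rewrite (Series_incr_1 (fun n => / (x + INR n) ^ k))
    by now apply ex_series_hurwitz.
  simpl INR at 2. rewrite Rplus_0_r.
  rewrite (Series_ext (fun n => / (x + 1 + INR n) ^ k)
                      (fun n => / (x + INR (S n)) ^ k)).
  - ring.
  - intros n. rewrite S_INR. do 2 f_equal. ring.
Qed.

(** Partial sums of the asymptotic expansion of [trigamma]; telescoping works
    because the difference [p (1 / t) - p (1 / (t + 1))] misses [1 / t ^ 2] by a
    quotient of polynomials with coefficients of one sign.  The bounds on
    [hurwitz 3] and [hurwitz 4] below come from the differentiated expansions. *)
Lemma hurwitz2_lower (y : R) :
  0 < y -> / y + / (2 * y ^ 2) + / (6 * y ^ 3) - / (30 * y ^ 5) <= hurwitz 2 y.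
Proof.
  intros Hy.
  set (p := fun s => s + s ^ 2 / 2 + s ^ 3 / 6 - s ^ 5 / 30).
  replace (/ y + _ + _ - _) with (p (/ (y + INR 0)))
    by (unfold p; simpl INR; field; lra).
  apply (telescope_le_Series (fun n => p (/ (y + INR n)))).
  - apply is_lim_seq_poly_inv_shift; [exact Hy | | unfold p; field].
    unfold p. now auto_derive.
  - now apply ex_series_inv_square.
  - intros n. rewrite S_INR. assert (Ht := shift_pos y n Hy).
    replace (y + (INR n + 1)) with (y + INR n + 1) by ring.
    revert Ht. generalize (y + INR n). intros t Ht.
    apply Rminus_le_0.
    replace (_ - _) with ((1 + 5 * t + 5 * t ^ 2) / (30 * t ^ 5 * (t + 1) ^ 5))
      by (unfold p; field; lra).
    apply Rdiv_le_0_compat; [nra | ].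
    assert (0 < t ^ 5) by now apply pow_lt.
    assert (0 < (t + 1) ^ 5) by (apply pow_lt; lra).
    nra.
Qed.

Lemma hurwitz2_lower_inv (y : R) : 0 < y -> / y <= hurwitz 2 y.
Proof.
  intros Hy.
  replace (/ y) with (/ (y + INR 0)) by (simpl INR; f_equal; ring).
  apply (telescope_le_Series (fun n => / (y + INR n))).
  - now apply is_lim_seq_inv_shift.
  - now apply ex_series_inv_square.
  - intros n. rewrite S_INR. assert (Ht := shift_pos y n Hy).
    replace (y + (INR n + 1)) with (y + INR n + 1) by ring.
    revert Ht. generalize (y + INR n). intros t Ht.
    apply Rminus_le_0.
    replace (_ - _) with (1 / (t ^ 2 * (t + 1))) by (field; lra).
    apply Rdiv_le_0_compat; nra.
Qed.

Lemma hurwitz2_upper (y : R) : 0 < y -> hurwitz 2 y <= / y + / y ^ 2.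
Proof.
  intros Hy.
  set (p := fun s => s + s ^ 2).
  replace (/ y + _) with (p (/ (y + INR 0)))
    by (unfold p; simpl INR; field; lra).
  apply (Series_le_telescope (fun n => p (/ (y + INR n)))).
  - apply is_lim_seq_poly_inv_shift; [exact Hy | | unfold p; field].
    unfold p. now auto_derive.
  - now apply ex_series_inv_square.
  - intros n. rewrite S_INR. assert (Ht := shift_pos y n Hy).
    replace (y + (INR n + 1)) with (y + INR n + 1) by ring.
    revert Ht. generalize (y + INR n). intros t Ht.
    apply Rminus_le_0.
    replace (_ - _) with (1 / (t * (t + 1) ^ 2)) by (unfold p; field; lra).
    apply Rdiv_le_0_compat; nra.
Qed.

Lemma hurwitz3_upper (y : R) :
  0 < y -> 2 * hurwitz 3 y <= / y ^ 2 + / y ^ 3 + / (2 * y ^ 4).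
Proof.
  intros Hy. unfold hurwitz. rewrite <- Series_scal_l.
  set (p := fun s => s ^ 2 + s ^ 3 + s ^ 4 / 2).
  replace (/ y ^ 2 + _ + _) with (p (/ (y + INR 0)))
    by (unfold p; simpl INR; field; lra).
  apply (Series_le_telescope (fun n => p (/ (y + INR n)))).
  - apply is_lim_seq_poly_inv_shift; [exact Hy | | unfold p; field].
    unfold p. now auto_derive.
  - apply (@ex_series_scal_l R_AbsRing R_NormedModule 2 (fun n => / (y + INR n) ^ 3)).
    now apply ex_series_hurwitz; [ | lia].
  - intros n. rewrite S_INR. assert (Ht := shift_pos y n Hy).
    replace (y + (INR n + 1)) with (y + INR n + 1) by ring.
    revert Ht. generalize (y + INR n). intros t Ht.
    apply Rminus_le_0.
    replace (_ - _) with ((1 + 2 * t) / (2 * t ^ 4 * (t + 1) ^ 4))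
      by (unfold p; field; lra).
    apply Rdiv_le_0_compat; [lra | ].
    assert (0 < t ^ 4) by now apply pow_lt.
    assert (0 < (t + 1) ^ 4) by (apply pow_lt; lra).
    nra.
Qed.

Lemma hurwitz4_lower (y : R) :
  0 < y -> 2 / y ^ 3 + 3 / y ^ 4 + 2 / y ^ 5 - / y ^ 7 <= 6 * hurwitz 4 y.
Proof.
  intros Hy. unfold hurwitz. rewrite <- Series_scal_l.
  set (p := fun s => 2 * s ^ 3 + 3 * s ^ 4 + 2 * s ^ 5 - s ^ 7).
  replace (2 / y ^ 3 + _ + _ - _) with (p (/ (y + INR 0)))
    by (unfold p; simpl INR; field; lra).
  apply (telescope_le_Series (fun n => p (/ (y + INR n)))).
  - apply is_lim_seq_poly_inv_shift; [exact Hy | | unfold p; ring].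
    unfold p. now auto_derive.
  - apply (@ex_series_scal_l R_AbsRing R_NormedModule 6 (fun n => / (y + INR n) ^ 4)).
    now apply ex_series_hurwitz; [ | lia].
  - intros n. rewrite S_INR. assert (Ht := shift_pos y n Hy).
    replace (y + (INR n + 1)) with (y + INR n + 1) by ring.
    revert Ht. generalize (y + INR n). intros t Ht.
    apply Rminus_le_0.
    replace (_ - _)
      with ((1 + 7 * t + 19 * t ^ 2 + 24 * t ^ 3 + 12 * t ^ 4)
            / (t ^ 7 * (t + 1) ^ 7)) by (unfold p; field; lra).
    apply Rdiv_le_0_compat.
    + assert (0 < t ^ 2) by now apply pow_lt.
      assert (0 < t ^ 3) by now apply pow_lt.
      assert (0 < t ^ 4) by now apply pow_lt.
      lra.
    + apply Rmult_lt_0_compat; apply pow_lt; lra.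
Qed.

(** * An antiderivative of the trigamma series *)

(** The digamma function shifted by Euler's constant. *)
Definition digamma_series (x : R) : R :=
  Series (fun n => / (1 + INR n) - / (x + INR n)).

Lemma ex_series_digamma (x : R) :
  0 < x -> ex_series (fun n => / (1 + INR n) - / (x + INR n)).
Proof.
  intros Hx.
  set (m := Rmin 1 x).
  assert (Hm : 0 < m) by (apply Rmin_pos; lra).
  assert (Hm1 : m <= 1) by apply Rmin_l. assert (Hmx : m <= x) by apply Rmin_r.
  apply (ex_series_dominated _ (fun n => Rabs (x - 1) * / (m + INR n) ^ 2)).
  - intros n. assert (Hn := pos_INR n).
    replace (/ (1 + INR n) - / (x + INR n))
      with ((x - 1) * / ((1 + INR n) * (x + INR n))) by (field; lra).
    rewrite Rabs_mult. apply Rmult_le_compat_l; [apply Rabs_pos | ].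
    rewrite Rabs_right by (apply Rle_ge; left; apply Rinv_0_lt_compat; nra).
    apply Rinv_le_contravar; [apply pow_lt; lra | nra].
  - apply (@ex_series_scal_l R_AbsRing R_NormedModule (Rabs (x - 1))
             (fun n => / (m + INR n) ^ 2)).
    now apply ex_series_inv_square.
Qed.

Lemma is_derive_digamma_series (x : R) :
  0 < x -> is_derive digamma_series x (hurwitz 2 x).
Proof.
  intros Hx.
  apply (is_derive_Series (fun n t => / (1 + INR n) - / (t + INR n))
    (fun n t => / (t + INR n) ^ 2)
    (fun n t => - INR 2 * / (t + INR n) ^ 3)
    (fun n => 2 * / (x / 2 + INR n) ^ 3) x (x / 2)); [lra | | | | | | ].
  - intros n t Ht. apply half_ball_lower in Ht; [ | exact Hx].
    assert (H := shift_pos t n ltac:(lra)).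
    auto_derive; [lra | field; lra].
  - intros n t Ht. apply half_ball_lower in Ht; [ | exact Hx].
    apply (is_derive_inv_shift_pow 1), shift_pos. lra.
  - intros n t Ht. apply half_ball_lower in Ht; [ | exact Hx].
    assert (H3 : 0 < / (t + INR n) ^ 3).
    { apply Rinv_0_lt_compat, pow_lt, shift_pos. lra. }
    simpl INR.
    rewrite Rabs_left by nra.
    assert (H4 := inv_shift_pow_le 3 n (x / 2) t). lra.
  - apply (@ex_series_scal_l R_AbsRing R_NormedModule 2
             (fun n => / (x / 2 + INR n) ^ 3)).
    apply ex_series_hurwitz; [lra | lia].
  - intros t Ht. apply half_ball_lower in Ht; [ | exact Hx].
    apply ex_series_digamma. lra.
  - now apply ex_series_inv_square.
Qed.

Lemma digamma_series_shift (x : R) :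
  0 < x -> digamma_series (x + 1) = digamma_series x + / x.
Proof.
  intros Hx. unfold digamma_series.
  assert (H1 := ex_series_digamma x Hx).
  assert (H2 := ex_series_digamma (x + 1) ltac:(lra)).
  apply Rplus_eq_reg_r with (- Series (fun n => / (1 + INR n) - / (x + INR n))).
  change (?a + - ?b) with (a - b).
  rewrite <- Series_minus by assumption.
  transitivity (/ (x + INR 0)).
  - apply is_series_unique.
    apply (is_series_ext (fun n => / (x + INR n) - / (x + INR (S n)))).
    + intros n. rewrite S_INR.
      replace (x + 1 + INR n) with (x + (INR n + 1)) by ring. simpl. ring.
    + apply (is_series_telescope (fun n => / (x + INR n))).
      now apply is_lim_seq_inv_shift.
  - simpl INR. rewrite Rplus_0_r. ring.
Qed.

(** The linear term makes the value at [2] equal to the value at [1], as the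
    functional equation of [ln Gamma] requires. *)
Definition log_gamma_series (x : R) : R :=
  RInt digamma_series 1 x - RInt digamma_series 1 2 * (x - 1).

Lemma is_derive_log_gamma_series (x : R) :
  0 < x ->
  is_derive log_gamma_series x (digamma_series x - RInt digamma_series 1 2).
Proof.
  intros Hx. unfold log_gamma_series.
  apply (is_derive_minus (fun x => RInt digamma_series 1 x)
           (fun x => RInt digamma_series 1 2 * (x - 1))).
  - assert (Hc : forall t, 0 < t -> continuous digamma_series t).
    { intros t Ht. apply (ex_derive_continuous digamma_series t).
      eexists. now apply is_derive_digamma_series. }
    apply is_derive_RInt_pos; [exact Hc | lra | exact Hx].
  - generalize (RInt digamma_series 1 2). intros k. auto_derive; [exact I | ring].
Qed.

Lemma log_gamma_series_1 : log_gamma_series 1 = 0.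
Proof. unfold log_gamma_series. rewrite RInt_point. change zero with 0. ring. Qed.

Lemma log_gamma_series_shift (x : R) :
  0 < x -> log_gamma_series (x + 1) = log_gamma_series x + ln x.
Proof.
  intros Hx.
  set (d := fun t => log_gamma_series (t + 1) - log_gamma_series t - ln t).
  assert (Hd : forall t, 0 < t -> is_derive d t 0).
  { intros t Ht.
    replace 0 with ((1 * (digamma_series (t + 1) - RInt digamma_series 1 2)
       - (digamma_series t - RInt digamma_series 1 2)) - / t)
      by (rewrite digamma_series_shift by exact Ht; ring).
    apply (is_derive_minus
      (fun t => log_gamma_series (t + 1) - log_gamma_series t) ln).
    - apply (is_derive_minus (fun t => log_gamma_series (t + 1)) log_gamma_series).
      + apply (is_derive_comp log_gamma_series (fun t => t + 1)).
        * apply is_derive_log_gamma_series. lra.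
        * auto_derive; [exact I | ring].
      + now apply is_derive_log_gamma_series.
    - now apply is_derive_ln. }
  assert (H1 : d 1 = 0).
  { unfold d. rewrite log_gamma_series_1, ln_1. unfold log_gamma_series.
    replace (1 + 1) with 2 by ring. ring. }
  assert (E : d x = d 1).
  { destruct (Rle_dec x 1) as [H | H].
    - apply (derive_zero_eq d (fun _ => 0)); [exact H | | reflexivity].
      intros t Ht. apply Hd. lra.
    - symmetry. apply (derive_zero_eq d (fun _ => 0)); [lra | | reflexivity].
      intros t Ht. apply Hd. lra. }
  rewrite H1 in E. unfold d in E. lra.
Qed.

(** * Integrals over the positive half-line *)

Local Notation is_integral f l :=
  (is_RInt_gen f (at_right 0) (Rbar_locally p_infty) l).

Lemma endpoints_pos :
  filter_prod (at_right 0) (Rbar_locally p_infty)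
    (fun ab : R * R => 0 < fst ab <= snd ab).
Proof.
  apply (Filter_prod _ _ _ (fun a => 0 < a < 1) (fun b => 1 < b)).
  - exists (mkposreal 1 Rlt_0_1). intros t Ht H0.
    change (Rabs (t - 0) < 1) in Ht. apply Rabs_def2 in Ht. lra.
  - now exists 1.
  - intros a b Ha Hb. simpl. lra.
Qed.

Lemma is_integral_ext (f g : R -> R) (l : R) :
  (forall t, 0 < t -> f t = g t) -> is_integral f l -> is_integral g l.
Proof.
  intros Hfg. apply (is_RInt_gen_ext f g).
  apply (filter_imp (F := filter_prod (at_right 0) (Rbar_locally p_infty)))
    with (2 := endpoints_pos).
  intros [a b] Hab t Ht. simpl in *. apply Hfg.
  assert (0 < Rmin a b) by (apply Rmin_pos; lra). lra.
Qed.

Lemma is_integral_le (f g : R -> R) (lf lg : R) :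
  (forall t, 0 < t -> f t <= g t) ->
  is_integral f lf -> is_integral g lg -> lf <= lg.
Proof.
  intros Hfg Hf Hg. apply Rminus_le_0.
  assert (Hd := is_RInt_gen_minus g f lg lf Hg Hf).
  apply Rle_trans with (Rabs (lg - lf)); [apply Rabs_pos | ].
  apply (RInt_gen_norm (V := R_CompleteNormedModule)
           (Fa := at_right 0) (Fb := Rbar_locally p_infty)
           (fun t => g t - f t) (fun t => g t - f t)); [ | | exact Hd | exact Hd].
  - apply (filter_imp (F := filter_prod (at_right 0) (Rbar_locally p_infty)))
      with (2 := endpoints_pos).
    intros [a b] Hab. simpl in *. lra.
  - apply (filter_imp (F := filter_prod (at_right 0) (Rbar_locally p_infty)))
      with (2 := endpoints_pos).
    intros [a b] Hab t Ht. simpl in *. change norm with Rabs.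
    specialize (Hfg t ltac:(lra)). rewrite Rabs_right; lra.
Qed.

Lemma is_integral_derive (F F' : R -> R) (l0 l1 : R) :
  (forall t, 0 < t -> is_derive F t (F' t)) ->
  (forall t, 0 < t -> continuous F' t) ->
  filterlim F (at_right 0) (locally l0) ->
  filterlim F (Rbar_locally p_infty) (locally l1) ->
  is_integral F' (l1 - l0).
Proof.
  intros HF HF' H0 H1.
  apply (is_integral_ext (Derive F)).
  { intros t Ht. now apply is_derive_unique, HF. }
  apply is_RInt_gen_Derive; [ | | exact H0 | exact H1].
  - apply (filter_imp (F := filter_prod (at_right 0) (Rbar_locally p_infty)))
      with (2 := endpoints_pos).
    intros [a b] Hab t Ht. simpl in *. exists (F' t). apply HF.
    assert (0 < Rmin a b) by (apply Rmin_pos; lra). lra.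
  - apply (filter_imp (F := filter_prod (at_right 0) (Rbar_locally p_infty)))
      with (2 := endpoints_pos).
    intros [a b] Hab t Ht. simpl in *.
    assert (Ht0 : 0 < t).
    { assert (0 < Rmin a b) by (apply Rmin_pos; lra). lra. }
    apply (continuous_ext_loc (Derive F) F'); [ | now apply HF'].
    exists (mkposreal t Ht0). intros s Hs. change (Rabs (s - t) < t) in Hs.
    apply Rabs_def2 in Hs. symmetry. apply is_derive_unique, HF. lra.
Qed.

(** The value is the supremum of the integrals over compact intervals, which
    the bounded antiderivative [F] of the dominating function keeps below
    [B]. *)
Lemma is_integral_dominated (f F F' : R -> R) (B : R) :
  (forall t, 0 < t -> continuous f t) ->
  (forall t, 0 < t -> 0 <= f t <= F' t) ->
  (forall t, 0 < t -> is_derive F t (F' t)) ->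
  (forall t, 0 < t -> 0 <= F t <= B) ->
  exists l, is_integral f l /\ forall a b, 0 < a <= b -> RInt f a b <= l.
Proof.
  intros Hc Hf HF HB.
  assert (Hub : forall a b, 0 < a <= b -> RInt f a b <= B).
  { intros a b Hab.
    assert (H : F a - RInt f a a <= F b - RInt f a b).
    { apply (derive_nonneg_le (fun t => F t - RInt f a t) (fun t => F' t - f t)); [lra | | ].
      - intros t Ht. apply (is_derive_minus F (fun t => RInt f a t)).
        + apply HF. lra.
        + apply is_derive_RInt_pos; [exact Hc | lra | lra].
      - intros t Ht. specialize (Hf t ltac:(lra)). lra. }
    rewrite RInt_point in H. change zero with 0 in H.
    assert (Ha := HB a ltac:(lra)). assert (Hb := HB b ltac:(lra)). lra. }
  assert (Hincr : forall a0 b0 a b, 0 < a <= a0 -> a0 <= b0 <= b ->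
             RInt f a0 b0 <= RInt f a b).
  { intros a0 b0 a b Ha Hb.
    assert (E1 := RInt_Chasles f a a0 b
      ltac:(apply ex_RInt_pos; [exact Hc | lra | lra])
      ltac:(apply ex_RInt_pos; [exact Hc | lra | lra])).
    assert (E2 := RInt_Chasles f a0 b0 b
      ltac:(apply ex_RInt_pos; [exact Hc | lra | lra])
      ltac:(apply ex_RInt_pos; [exact Hc | lra | lra])).
    change plus with Rplus in E1, E2.
    assert (0 <= RInt f a a0).
    { apply RInt_ge_0; [lra | apply ex_RInt_pos; [exact Hc | lra | lra] | ].
      intros t Ht. apply Hf. lra. }
    assert (0 <= RInt f b0 b).
    { apply RInt_ge_0; [lra | apply ex_RInt_pos; [exact Hc | lra | lra] | ].
      intros t Ht. apply Hf. lra. }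
    lra. }
  destruct (completeness (fun v => exists a b, 0 < a <= b /\ v = RInt f a b))
    as [l [Hl1 Hl2]].
  - exists B. intros v (a & b & Hab & ->). now apply Hub.
  - exists (RInt f 1 1), 1, 1. split; [lra | reflexivity].
  - exists l.
    assert (Hle : forall a b, 0 < a <= b -> RInt f a b <= l).
    { intros a b Hab. apply Hl1. now exists a, b. }
    split; [ | exact Hle].
    intros P [eps HP].
    assert (Hex : exists a0 b0, 0 < a0 <= b0 /\ l - eps < RInt f a0 b0).
    { apply Classical_Prop.NNPP. intros Hno.
      assert (H : l <= l - eps).
      { apply Hl2. intros v (a & b & Hab & ->).
        apply Rnot_lt_le. intros Hlt. apply Hno. now exists a, b. }
      assert (He := cond_pos eps). lra. }
    destruct Hex as (a0 & b0 & Hab0 & Hlt).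
    apply (Filter_prod _ _ _ (fun a => 0 < a < a0) (fun b => b0 < b)).
    + assert (Ha0 : 0 < a0) by lra.
      exists (mkposreal a0 Ha0). intros t Ht H0.
      change (Rabs (t - 0) < a0) in Ht. apply Rabs_def2 in Ht. lra.
    + now exists b0.
    + intros a b Ha Hb. simpl. exists (RInt f a b). split.
      * apply (RInt_correct f a b), ex_RInt_pos; [exact Hc | lra | lra].
      * apply HP. change (Rabs (RInt f a b - l) < eps).
        assert (H1 := Hle a b ltac:(lra)).
        assert (H2 := Hincr a0 b0 a b ltac:(lra) ltac:(lra)).
        apply Rabs_def1; lra.
Qed.

(** * Euler's integral *)

Definition euler_integrand (x t : R) : R := Rpower t (x - 1) * exp (- t).

Lemma euler_integrand_exp (x t : R) :
  euler_integrand x t = exp ((x - 1) * ln t - t).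
Proof. unfold euler_integrand, Rpower. now rewrite <- exp_plus. Qed.

Lemma continuous_euler_integrand (x t : R) :
  0 < t -> continuous (euler_integrand x) t.
Proof.
  intros Ht. apply (ex_derive_continuous (euler_integrand x) t).
  unfold euler_integrand, Rpower. auto_derive. lra.
Qed.

Lemma exp_opp_le (x t : R) :
  0 < x -> 0 < t ->
  exp (- t) <= exp ((x + 1) * ln (x + 1) - x) * exp (- (x + 1) * ln (1 + t)).
Proof.
  intros Hx Ht. rewrite <- exp_plus. apply exp_nondecr.
  (* the tangent of [ln] at [x + 1] *)
  assert (H : ln ((1 + t) / (x + 1)) <= (1 + t) / (x + 1) - 1).
  { assert (He := exp_ineq1_le (ln ((1 + t) / (x + 1)))).
    rewrite exp_ln in He by (apply Rdiv_lt_0_compat; lra). lra. }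
  rewrite ln_div in H by lra.
  assert (E : (1 + t) / (x + 1) * (x + 1) = 1 + t) by (field; lra).
  nra.
Qed.

(** The integrand is dominated by a multiple of the derivative of
    [(t / (1 + t)) ^ x], which is bounded at both ends of the half-line. *)
Lemma euler_integral_exists (x : R) :
  0 < x ->
  exists l, is_integral (euler_integrand x) l /\
    forall a b, 0 < a <= b -> RInt (euler_integrand x) a b <= l.
Proof.
  intros Hx.
  set (C := exp ((x + 1) * ln (x + 1) - x)).
  assert (HC : 0 < C) by apply exp_pos.
  apply (is_integral_dominated (euler_integrand x)
    (fun t => C / x * exp (x * (ln t - ln (1 + t))))
    (fun t => C / x * (x * (/ t - / (1 + t)) * exp (x * (ln t - ln (1 + t)))))
    (C / x)).
  - intros t Ht. now apply continuous_euler_integrand.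
  - intros t Ht. rewrite euler_integrand_exp. split; [left; apply exp_pos | ].
    replace (C / x * (x * (/ t - / (1 + t)) * exp (x * (ln t - ln (1 + t)))))
      with (exp ((x - 1) * ln t) * (C * exp (- (x + 1) * ln (1 + t)))).
    + unfold Rminus at 1. rewrite exp_plus.
      apply Rmult_le_compat_l; [left; apply exp_pos | now apply exp_opp_le].
    + replace (x * (ln t - ln (1 + t)))
        with ((x - 1) * ln t + - (x + 1) * ln (1 + t) + (ln t + ln (1 + t))) by ring.
      rewrite !exp_plus, !exp_ln by lra. field. lra.
  - intros t Ht. auto_derive; [repeat split; lra | unfold Rminus; ring].
  - intros t Ht.
    assert (HCx : 0 < C / x) by (apply Rdiv_lt_0_compat; lra).
    assert (H1 : 0 < exp (x * (ln t - ln (1 + t)))) by apply exp_pos.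
    assert (H2 : exp (x * (ln t - ln (1 + t))) <= 1).
    { apply Rle_trans with (exp 0); [apply exp_nondecr | right; apply exp_0].
      assert (ln t < ln (1 + t)) by (apply ln_increasing; lra). nra. }
    nra.
Qed.

Lemma Gamma_is_integral (x : R) : 0 < x -> is_integral (euler_integrand x) (Gamma x).
Proof.
  intros Hx. destruct (euler_integral_exists x Hx) as [l [Hl _]].
  replace (Gamma x) with l; [exact Hl | ].
  symmetry. exact (is_RInt_gen_unique (euler_integrand x) l Hl).
Qed.

Lemma Gamma_pos (x : R) : 0 < x -> 0 < Gamma x.
Proof.
  intros Hx. destruct (euler_integral_exists x Hx) as [l [Hl Hle]].
  replace (Gamma x) with l
    by (symmetry; exact (is_RInt_gen_unique (euler_integrand x) l Hl)).
  apply Rlt_le_trans with (2 := Hle 1 2 ltac:(lra)).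
  apply RInt_gt_0; [lra | | ].
  - intros t Ht. rewrite euler_integrand_exp. apply exp_pos.
  - intros t Ht. apply continuous_euler_integrand. lra.
Qed.

Lemma Gamma_shift (x : R) : 0 < x -> Gamma (x + 1) = x * Gamma x.
Proof.
  intros Hx.
  (* integration by parts: [t ^ x * exp (- t)] vanishes at both ends *)
  assert (H : is_integral
    (fun t => x * euler_integrand x t - euler_integrand (x + 1) t) (0 - 0)).
  { apply (is_integral_derive (fun t => exp (x * ln t - t))).
    - intros t Ht. rewrite !euler_integrand_exp. auto_derive; [exact Ht | ].
      assert (E : exp ((x - 1) * ln t - t) = exp (x * ln t - t) / t).
      { replace ((x - 1) * ln t - t) with (x * ln t - t + - ln t) by ring.
        now rewrite exp_plus, exp_Ropp, exp_ln. }
      rewrite E. replace (x + 1 - 1) with x by ring. unfold Rminus, Rdiv. ring.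
    - intros t Ht.
      apply (continuous_minus (fun t => x * euler_integrand x t) (euler_integrand (x + 1))).
      + apply (continuous_scal_r x (euler_integrand x)). now apply continuous_euler_integrand.
      + now apply continuous_euler_integrand.
    - apply filterlim_locally. intros eps.
      exists (mkposreal _ (exp_pos (ln eps / x))). intros t Ht H0. simpl in Ht.
      change (Rabs (t - 0) < exp (ln eps / x)) in Ht. rewrite Rminus_0_r in Ht.
      rewrite Rabs_right in Ht by lra.
      change (Rabs (exp (x * ln t - t) - 0) < eps). rewrite Rminus_0_r.
      rewrite Rabs_right by (left; apply exp_pos).
      rewrite <- (exp_ln eps) by apply cond_pos. apply exp_increasing.
      assert (Hl : ln t < ln eps / x).
      { rewrite <- (ln_exp (ln eps / x)). now apply ln_increasing. }
      assert (E : x * (ln eps / x) = ln eps) by (field; lra).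
      nra.
    - apply filterlim_locally. intros eps.
      set (C := exp ((x + 1) * ln (x + 1) - x)).
      assert (HC : 0 < C) by apply exp_pos.
      assert (He := cond_pos eps).
      exists (C / eps). intros t Ht.
      assert (Ht0 : 0 < t).
      { assert (0 < C / eps) by now apply Rdiv_lt_0_compat. lra. }
      change (Rabs (exp (x * ln t - t) - 0) < eps). rewrite Rminus_0_r.
      rewrite Rabs_right by (left; apply exp_pos).
      apply Rle_lt_trans with (C * / (1 + t)).
      + replace (C * / (1 + t))
          with (exp (x * ln (1 + t)) * (C * exp (- (x + 1) * ln (1 + t)))).
        * unfold Rminus. rewrite exp_plus.
          apply Rmult_le_compat; try (left; apply exp_pos).
          -- apply exp_nondecr. assert (ln t < ln (1 + t)) by (apply ln_increasing; lra). nra.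
          -- now apply exp_opp_le.
        * replace (- (x + 1) * ln (1 + t)) with (- ln (1 + t) + - (x * ln (1 + t))) by ring.
          rewrite exp_plus, !exp_Ropp, exp_ln by lra.
          assert (0 < exp (x * ln (1 + t))) by apply exp_pos.
          field. lra.
      + apply Rmult_lt_reg_r with (1 + t); [lra | ].
        rewrite Rmult_assoc, Rinv_l by lra.
        assert (E : C / eps * eps = C) by (field; lra). nra. }
  assert (H2 := is_RInt_gen_minus _ _ _ _
    (is_RInt_gen_scal _ x _ (Gamma_is_integral x Hx))
    (Gamma_is_integral (x + 1) ltac:(lra))).
  assert (E := is_RInt_gen_unique _ _ H).
  assert (E2 := is_RInt_gen_unique _ _ H2).
  change (RInt_gen (fun t => x * euler_integrand x t - euler_integrand (x + 1) t)
            (at_right 0) (Rbar_locally p_infty) = x * Gamma x - Gamma (x + 1)) in E2.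
  lra.
Qed.

Lemma Gamma_1 : Gamma 1 = 1.
Proof.
  assert (H : is_integral (euler_integrand 1) (0 - - 1)).
  { apply (is_integral_derive (fun t => - exp (- t))).
    - intros t Ht. rewrite euler_integrand_exp. auto_derive; [exact I | ].
      replace ((1 - 1) * ln t - t) with (- t) by ring. ring.
    - intros t Ht. now apply continuous_euler_integrand.
    - replace (-1) with (- exp (- 0)) by (rewrite Ropp_0, exp_0; ring).
      apply (filterlim_filter_le_1 (F := locally 0)).
      + apply filter_le_within.
      + apply (ex_derive_continuous (fun t => - exp (- t)) 0). now auto_derive.
    - apply filterlim_locally. intros eps. exists (- ln eps). intros t Ht.
      change (Rabs (- exp (- t) - 0) < eps). rewrite Rminus_0_r, Rabs_Ropp.
      rewrite Rabs_right by (left; apply exp_pos).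
      rewrite <- (exp_ln eps) by apply cond_pos. apply exp_increasing. lra. }
  unfold Gamma.
  transitivity (0 - - 1); [ | ring].
  exact (is_RInt_gen_unique (euler_integrand 1) (0 - - 1) H).
Qed.

(** * The Bohr-Mollerup theorem *)

Definition convex_pos (f : R -> R) : Prop :=
  forall x y l, 0 < x -> 0 < y -> 0 <= l <= 1 ->
    f (l * x + (1 - l) * y) <= l * f x + (1 - l) * f y.

Lemma tangents_below_convex (f f' : R -> R) :
  (forall x y, 0 < x -> 0 < y -> f x + f' x * (y - x) <= f y) -> convex_pos f.
Proof.
  intros Ht x y l Hx Hy Hl.
  set (z := l * x + (1 - l) * y).
  assert (Hz : 0 < z).
  { unfold z. destruct (Req_dec l 0) as [-> | H]; [lra | ].
    assert (0 < l * x) by (apply Rmult_lt_0_compat; lra).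
    assert (0 <= (1 - l) * y) by (apply Rmult_le_pos; lra). lra. }
  assert (H1 := Ht z x Hz Hx). assert (H2 := Ht z y Hz Hy).
  apply (Rmult_le_compat_l l) in H1; [ | lra].
  apply (Rmult_le_compat_l (1 - l)) in H2; [ | lra].
  replace (f z) with (l * (f z + f' z * (x - z)) + (1 - l) * (f z + f' z * (y - z)))
    by (unfold z; ring).
  lra.
Qed.

Lemma derive_incr_convex (f f' : R -> R) :
  (forall x, 0 < x -> is_derive f x (f' x)) ->
  (forall x y, 0 < x <= y -> f' x <= f' y) -> convex_pos f.
Proof.
  intros Hf Hmono. apply (tangents_below_convex f f'). intros x y Hx Hy.
  destruct (Rtotal_order x y) as [H | [-> | H]].
  - destruct (mean_value f f' x y H) as [t [Ht E]]; [intros; apply Hf; lra | ].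
    specialize (Hmono x t ltac:(lra)). nra.
  - lra.
  - destruct (mean_value f f' y x H) as [t [Ht E]]; [intros; apply Hf; lra | ].
    specialize (Hmono t x ltac:(lra)). nra.
Qed.

Lemma exp_convex (p q l : R) :
  0 <= l <= 1 -> exp (l * p + (1 - l) * q) <= l * exp p + (1 - l) * exp q.
Proof.
  intros Hl. set (z := l * p + (1 - l) * q).
  assert (Ht : forall u, exp z + exp z * (u - z) <= exp u).
  { intros u. replace (exp u) with (exp z * exp (u - z))
      by (rewrite <- exp_plus; f_equal; ring).
    assert (Hz := exp_pos z). assert (Hu := exp_ineq1_le (u - z)). nra. }
  assert (H1 := Ht p). assert (H2 := Ht q).
  apply (Rmult_le_compat_l l) in H1; [ | lra].
  apply (Rmult_le_compat_l (1 - l)) in H2; [ | lra].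
  replace (exp z) with (l * (exp z + exp z * (p - z)) + (1 - l) * (exp z + exp z * (q - z)))
    by (unfold z; ring).
  lra.
Qed.

(** Hoelder's inequality, obtained by integrating Young's inequality for the
    two integrands normalised to have integral [1]. *)
Lemma log_Gamma_convex : convex_pos (fun x => ln (Gamma x)).
Proof.
  intros x y l Hx Hy Hl.
  assert (Hz : 0 < l * x + (1 - l) * y).
  { destruct (Req_dec l 0) as [-> | H]; [lra | ].
    assert (0 < l * x) by (apply Rmult_lt_0_compat; lra).
    assert (0 <= (1 - l) * y) by (apply Rmult_le_pos; lra). lra. }
  set (z := l * x + (1 - l) * y) in *.
  set (c := l * ln (Gamma x) + (1 - l) * ln (Gamma y)).
  assert (HGx := Gamma_pos x Hx). assert (HGy := Gamma_pos y Hy).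
  assert (HGz := Gamma_pos z Hz).
  rewrite <- (ln_exp c). apply ln_le; [exact HGz | ].
  replace (exp c) with (exp c * l / Gamma x * Gamma x + exp c * (1 - l) / Gamma y * Gamma y)
    by (field; lra).
  assert (Hsum := is_RInt_gen_plus _ _ _ _
    (is_RInt_gen_scal _ (exp c * l / Gamma x) _ (Gamma_is_integral x Hx))
    (is_RInt_gen_scal _ (exp c * (1 - l) / Gamma y) _ (Gamma_is_integral y Hy))).
  refine (is_integral_le _ _ _ _ _ (Gamma_is_integral z Hz) Hsum).
  intros t Ht.
  change (euler_integrand z t <= exp c * l / Gamma x * euler_integrand x t
                                 + exp c * (1 - l) / Gamma y * euler_integrand y t).
  rewrite !euler_integrand_exp.
  set (p := (x - 1) * ln t - t - ln (Gamma x)).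
  set (q := (y - 1) * ln t - t - ln (Gamma y)).
  replace ((z - 1) * ln t - t) with (c + (l * p + (1 - l) * q))
    by (unfold p, q, c, z; ring).
  replace ((x - 1) * ln t - t) with (p + ln (Gamma x)) by (unfold p; ring).
  replace ((y - 1) * ln t - t) with (q + ln (Gamma y)) by (unfold q; ring).
  rewrite (exp_plus c), (exp_plus p), (exp_plus q), !(exp_ln (Gamma _)) by assumption.
  replace (exp c * l / Gamma x * (exp p * Gamma x)
           + exp c * (1 - l) / Gamma y * (exp q * Gamma y))
    with (exp c * (l * exp p + (1 - l) * exp q)) by (field; lra).
  apply Rmult_le_compat_l; [left; apply exp_pos | now apply exp_convex].
Qed.

(** For [0 < x <= 1], convexity squeezes [f (n + x) - f n] between
    [x * ln (n - 1)] and [x * ln n], which differ by at most [1 / (n - 1)].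
    Both [f] and [g] obey this, so their difference, which has period [1], is
    constant. *)
Lemma bohr_mollerup_unique (f g : R -> R) :
  convex_pos f -> convex_pos g ->
  (forall x, 0 < x -> f (x + 1) = f x + ln x) ->
  (forall x, 0 < x -> g (x + 1) = g x + ln x) ->
  f 1 = g 1 -> forall x, 0 < x -> f x = g x.
Proof.
  intros Cf Cg Ef Eg E1.
  assert (Hup : forall h, convex_pos h -> (forall x, 0 < x -> h (x + 1) = h x + ln x) ->
     forall n x, 1 < n -> 0 < x <= 1 ->
       h n + x * ln (n - 1) <= h (n + x) <= h n + x * ln n).
  { intros h Ch Eh n x Hn Hx. split.
    - assert (Hc := Ch (n + x) (n - 1) (/ (1 + x))).
      assert (Hi : 0 < / (1 + x) <= 1).
      { split; [apply Rinv_0_lt_compat; lra | ].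
        rewrite <- Rinv_1. apply Rinv_le_contravar; lra. }
      specialize (Hc ltac:(lra) ltac:(lra) ltac:(lra)).
      replace (/ (1 + x) * (n + x) + (1 - / (1 + x)) * (n - 1)) with n in Hc by (field; lra).
      replace (/ (1 + x) * h (n + x) + (1 - / (1 + x)) * h (n - 1))
        with ((h (n + x) + x * h (n - 1)) / (1 + x)) in Hc by (field; lra).
      apply (Rmult_le_compat_r (1 + x)) in Hc; [ | lra].
      replace ((h (n + x) + x * h (n - 1)) / (1 + x) * (1 + x))
        with (h (n + x) + x * h (n - 1)) in Hc by (field; lra).
      assert (E := Eh (n - 1) ltac:(lra)). replace (n - 1 + 1) with n in E by ring.
      nra.
    - assert (Hc := Ch (n + 1) n x ltac:(lra) ltac:(lra) ltac:(lra)).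
      rewrite (Eh n) in Hc by lra.
      replace (x * (n + 1) + (1 - x) * n) with (n + x) in Hc by ring. lra. }
  set (d := fun x => f x - g x).
  assert (Hper : forall n x, 0 < x -> d (x + INR n) = d x).
  { induction n as [|n IH]; intros x Hx.
    - simpl. now rewrite Rplus_0_r.
    - rewrite S_INR, <- Rplus_assoc. unfold d.
      rewrite Ef, Eg by now apply shift_pos.
      specialize (IH x Hx). unfold d in IH. lra. }
  assert (Hd1 : d 1 = 0) by (unfold d; lra).
  assert (Hunit : forall x, 0 < x <= 1 -> d x = 0).
  { intros x Hx. apply cond_eq. intros eps Heps. rewrite Rminus_0_r.
    destruct (INR_archimed eps 1 Heps) as [n Hn].
    assert (Hn0 : 0 < INR n).
    { apply Rnot_le_lt. intros H. nra. }
    set (m := 1 + INR n).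
    assert (Hf := Hup f Cf Ef m x ltac:(unfold m; lra) Hx).
    assert (Hg := Hup g Cg Eg m x ltac:(unfold m; lra) Hx).
    assert (P1 := Hper n 1 ltac:(lra)). fold m in P1. rewrite Hd1 in P1.
    assert (P2 := Hper n (1 + x) ltac:(lra)).
    replace (1 + x + INR n) with (m + x) in P2 by (unfold m; ring).
    assert (P3 := Hper 1%nat x ltac:(lra)). simpl INR in P3.
    rewrite (Rplus_comm x 1), <- P2 in P3.
    assert (Hln : ln m - ln (m - 1) <= / INR n).
    { replace (m - 1) with (INR n) by (unfold m; ring).
      rewrite <- ln_div by (unfold m; lra).
      assert (Hq : 0 < m / INR n) by (apply Rdiv_lt_0_compat; unfold m; lra).
      assert (He := exp_ineq1_le (ln (m / INR n))). rewrite exp_ln in He by exact Hq.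
      replace (m / INR n) with (1 + / INR n) in He at 2 by (unfold m; field; lra).
      lra. }
    assert (Hi : / INR n < eps).
    { apply Rmult_lt_reg_r with (INR n); [exact Hn0 | ]. rewrite Rinv_l by lra. lra. }
    assert (Hl0 : 0 <= ln m - ln (m - 1)).
    { assert (ln (m - 1) < ln m) by (apply ln_increasing; unfold m; lra). lra. }
    assert (Hxl : x * (ln m - ln (m - 1)) <= ln m - ln (m - 1)) by nra.
    rewrite <- P3. unfold d in *. apply Rabs_def1; nra. }
  assert (Hall : forall n x, 0 < x <= INR (S n) -> d x = 0).
  { induction n as [|n IH]; intros x Hx.
    - apply Hunit. simpl in Hx. lra.
    - destruct (Rle_dec x 1) as [H | H]; [apply Hunit; lra | ].
      replace x with (x - 1 + INR 1) by (simpl; ring).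
      rewrite Hper by lra. apply IH. rewrite S_INR in Hx. lra. }
  intros x Hx. destruct (INR_unbounded x) as [n Hn].
  apply Rminus_diag_uniq. apply (Hall n). rewrite S_INR. lra.
Qed.

Lemma log_Gamma_eq_series (x : R) : 0 < x -> ln (Gamma x) = log_gamma_series x.
Proof.
  apply (bohr_mollerup_unique (fun x => ln (Gamma x)) log_gamma_series).
  - apply log_Gamma_convex.
  - apply (derive_incr_convex log_gamma_series
             (fun x => digamma_series x - RInt digamma_series 1 2)).
    + intros y Hy. now apply is_derive_log_gamma_series.
    + intros y z Hyz.
      assert (H : digamma_series y <= digamma_series z); [ | lra].
      apply (derive_nonneg_le digamma_series (hurwitz 2)); [lra | | ].
      * intros t Ht. apply is_derive_digamma_series. lra.
      * intros t Ht. left. apply hurwitz_pos; [lra | lia].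
  - intros y Hy. rewrite Gamma_shift, ln_mult; [ring | exact Hy | | exact Hy].
    now apply Gamma_pos.
  - apply log_gamma_series_shift.
  - now rewrite Gamma_1, ln_1, log_gamma_series_1.
Qed.

Lemma near_pos (x : R) (P : R -> Prop) :
  0 < x -> (forall t, 0 < t -> P t) -> locally x P.
Proof.
  intros Hx HP. exists (mkposreal x Hx). intros t Ht. apply HP.
  change (Rabs (t - x) < x) in Ht. apply Rabs_def2 in Ht. lra.
Qed.

Lemma digamma_eq_series (x : R) :
  0 < x -> digamma x = digamma_series x - RInt digamma_series 1 2.
Proof.
  intros Hx. unfold digamma.
  assert (E : forall t, 0 < t -> exp (log_gamma_series t) = Gamma t).
  { intros t Ht. rewrite <- log_Gamma_eq_series, exp_ln; auto using Gamma_pos. }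
  assert (Hd : is_derive Gamma x
     ((digamma_series x - RInt digamma_series 1 2) * exp (log_gamma_series x))).
  { apply (is_derive_ext_loc (fun t => exp (log_gamma_series t))).
    - now apply near_pos.
    - apply (is_derive_comp exp log_gamma_series);
        [apply is_derive_exp | now apply is_derive_log_gamma_series]. }
  rewrite (is_derive_unique _ _ _ Hd), E by exact Hx.
  assert (HG := Gamma_pos x Hx). field. lra.
Qed.

Lemma is_derive_log_Gamma (x : R) :
  0 < x -> is_derive (fun t => ln (Gamma t)) x (digamma x).
Proof.
  intros Hx. rewrite digamma_eq_series by exact Hx.
  apply (is_derive_ext_loc log_gamma_series).
  - apply near_pos; [exact Hx | ]. intros t Ht. symmetry. now apply log_Gamma_eq_series.
  - now apply is_derive_log_gamma_series.
Qed.

Lemma is_derive_digamma (x : R) : 0 < x -> is_derive digamma x (hurwitz 2 x).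
Proof.
  intros Hx.
  apply (is_derive_ext_loc (fun t => digamma_series t - RInt digamma_series 1 2)).
  - apply near_pos; [exact Hx | ]. intros t Ht. symmetry. now apply digamma_eq_series.
  - replace (hurwitz 2 x) with (hurwitz 2 x - 0) by ring.
    apply (is_derive_minus digamma_series (fun _ => RInt digamma_series 1 2)).
    + now apply is_derive_digamma_series.
    + apply (is_derive_const (RInt digamma_series 1 2)).
Qed.

Lemma trigamma_eq_hurwitz (x : R) : 0 < x -> trigamma x = hurwitz 2 x.
Proof. intros Hx. now apply is_derive_unique, is_derive_digamma. Qed.

(** * The Basel problem *)

Definition cos_moment (k n : nat) : R :=
  RInt (fun x => x ^ k * cos x ^ (2 * n)) 0 (PI / 2).

Lemma continuous_cos_moment (k n : nat) (x : R) :
  continuous (fun x => x ^ k * cos x ^ (2 * n)) x.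
Proof.
  apply (ex_derive_continuous (fun x => x ^ k * cos x ^ (2 * n)) x).
  now auto_derive.
Qed.

Lemma is_RInt_cos_moment (k n : nat) :
  is_RInt (fun x => x ^ k * cos x ^ (2 * n)) 0 (PI / 2) (cos_moment k n).
Proof.
  apply (RInt_correct (fun x => x ^ k * cos x ^ (2 * n)) 0 (PI / 2)).
  apply (ex_RInt_continuous (fun x => x ^ k * cos x ^ (2 * n))).
  intros z _. apply continuous_cos_moment.
Qed.

Lemma cos_moment0_step (n : nat) :
  (2 * INR n + 2) * cos_moment 0 (S n) = (2 * INR n + 1) * cos_moment 0 n.
Proof.
  assert (H : is_RInt (fun x => (2 * INR n + 2) * (x ^ 0 * cos x ^ (2 * S n))
                      - (2 * INR n + 1) * (x ^ 0 * cos x ^ (2 * n))) 0 (PI / 2)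
    (sin (PI / 2) * cos (PI / 2) ^ (2 * n + 1) - sin 0 * cos 0 ^ (2 * n + 1))).
  { apply (is_RInt_derive (fun x => sin x * cos x ^ (2 * n + 1))).
    - intros x _. auto_derive; [exact I | ].
      change (n + (n + 0))%nat with (2 * n)%nat.
      replace (pred (2 * n + 1)) with (2 * n)%nat by lia.
      replace (2 * S n)%nat with (2 * n + 2)%nat by lia.
      rewrite !plus_INR, mult_INR, !pow_add. simpl INR.
      set (c := cos x ^ (2 * n)). set (m := INR n).
      assert (E := sin2_cos2 x). unfold Rsqr in E. simpl pow.
      transitivity (c * (cos x * cos x) - (2 * m + 1) * c * (sin x * sin x));
        [ring | ].
      replace (sin x * sin x) with (1 - cos x * cos x) by lra. ring.
    - intros x _.
      apply (continuous_minus (fun x => (2 * INR n + 2) * (x ^ 0 * cos x ^ (2 * S n)))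
               (fun x => (2 * INR n + 1) * (x ^ 0 * cos x ^ (2 * n)))).
      + apply (continuous_scal_r (2 * INR n + 2) (fun x => x ^ 0 * cos x ^ (2 * S n))).
        apply continuous_cos_moment.
      + apply (continuous_scal_r (2 * INR n + 1) (fun x => x ^ 0 * cos x ^ (2 * n))).
        apply continuous_cos_moment. }
  assert (H2 := is_RInt_minus _ _ _ _ _ _
    (is_RInt_scal _ _ _ (2 * INR n + 2) _ (is_RInt_cos_moment 0 (S n)))
    (is_RInt_scal _ _ _ (2 * INR n + 1) _ (is_RInt_cos_moment 0 n))).
  assert (E := is_RInt_unique _ _ _ _ H). assert (E2 := is_RInt_unique _ _ _ _ H2).
  change (RInt (fun x => (2 * INR n + 2) * (x ^ 0 * cos x ^ (2 * S n))
                      - (2 * INR n + 1) * (x ^ 0 * cos x ^ (2 * n))) 0 (PI / 2)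
    = (2 * INR n + 2) * cos_moment 0 (S n) - (2 * INR n + 1) * cos_moment 0 n) in E2.
  rewrite E2, cos_PI2, sin_0, (pow_i (2 * n + 1)) in E by lia. lra.
Qed.

(** The integrand is the derivative of
    [x cos ^ (2n + 2) + (n + 1) x ^ 2 sin cos ^ (2n + 1)], which vanishes at
    both ends. *)
Lemma cos_moment2_step (n : nat) :
  cos_moment 0 (S n)
  + (INR n + 1) * ((2 * INR n + 2) * cos_moment 2 (S n)
                   - (2 * INR n + 1) * cos_moment 2 n) = 0.
Proof.
  set (g := fun x => x ^ 0 * cos x ^ (2 * S n)
    + (INR n + 1) * ((2 * INR n + 2) * (x ^ 2 * cos x ^ (2 * S n))
                   - (2 * INR n + 1) * (x ^ 2 * cos x ^ (2 * n)))).
  set (F := fun x => x * cos x ^ (2 * n + 2)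
                     + (INR n + 1) * (x ^ 2 * (sin x * cos x ^ (2 * n + 1)))).
  assert (H : is_RInt g 0 (PI / 2) (F (PI / 2) - F 0)).
  { apply (is_RInt_derive F g).
    - intros x _. unfold F, g. auto_derive; [exact I | ].
      change (n + (n + 0))%nat with (2 * n)%nat.
      replace (pred (2 * n + 1)) with (2 * n)%nat by lia.
      replace (pred (2 * n + 2)) with (2 * n + 1)%nat by lia.
      replace (2 * S n)%nat with (2 * n + 2)%nat by lia.
      rewrite !plus_INR, mult_INR, !pow_add. simpl INR.
      set (c := cos x ^ (2 * n)). set (m := INR n).
      assert (E := sin2_cos2 x). unfold Rsqr in E. simpl pow.
      transitivity (c * (cos x * cos x) + (m + 1) * (x * x)
          * (c * (cos x * cos x) - (2 * m + 1) * c * (sin x * sin x))); [ring | ].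
      replace (sin x * sin x) with (1 - cos x * cos x) by lra. ring.
    - intros x _. apply (ex_derive_continuous g x). unfold g. now auto_derive. }
  assert (H2 := is_RInt_plus _ _ _ _ _ _ (is_RInt_cos_moment 0 (S n))
   (is_RInt_scal _ _ _ (INR n + 1) _ (is_RInt_minus _ _ _ _ _ _
    (is_RInt_scal _ _ _ (2 * INR n + 2) _ (is_RInt_cos_moment 2 (S n)))
    (is_RInt_scal _ _ _ (2 * INR n + 1) _ (is_RInt_cos_moment 2 n))))).
  assert (E := is_RInt_unique _ _ _ _ H). assert (E2 := is_RInt_unique _ _ _ _ H2).
  change (RInt g 0 (PI / 2)
    = cos_moment 0 (S n) + (INR n + 1) * ((2 * INR n + 2) * cos_moment 2 (S n)
                   - (2 * INR n + 1) * cos_moment 2 n)) in E2.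
  rewrite <- E2, E. unfold F.
  rewrite cos_PI2, sin_0, (pow_i (2 * n + 1)), (pow_i (2 * n + 2)) by lia. ring.
Qed.

Lemma cos_moment0_pos (n : nat) : 0 < cos_moment 0 n.
Proof.
  assert (HPI := PI_RGT_0).
  apply RInt_gt_0; [lra | | ].
  - intros x Hx. simpl pow at 1. rewrite Rmult_1_l.
    apply pow_lt, cos_gt_0; lra.
  - intros x Hx. apply continuous_cos_moment.
Qed.

Lemma cos_moment2_nonneg (n : nat) : 0 <= cos_moment 2 n.
Proof.
  assert (HPI := PI_RGT_0).
  apply RInt_ge_0; [lra | | ].
  - eexists. apply is_RInt_cos_moment.
  - intros x Hx. apply Rmult_le_pos; [nra | ].
    apply pow_le. left. apply cos_gt_0; lra.
Qed.

Lemma mul_cos_le_sin (x : R) : 0 <= x <= PI -> x * cos x <= sin x.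
Proof.
  intros Hx.
  assert (H : sin 0 - 0 * cos 0 <= sin x - x * cos x).
  { apply (derive_nonneg_le (fun x => sin x - x * cos x) (fun x => x * sin x)); [lra | | ].
    - intros t _. auto_derive; [exact I | ring].
    - intros t Ht. apply Rmult_le_pos; [lra | apply sin_ge_0; lra]. }
  rewrite sin_0 in H. lra.
Qed.

(** Since [x * cos x <= sin x], the second moment of [cos ^ (2n + 2)] is at
    most the integral of [sin ^ 2 * cos ^ (2n)]. *)
Lemma cos_moment2_le (n : nat) :
  (2 * INR n + 1) * cos_moment 2 (S n) <= cos_moment 0 (S n).
Proof.
  assert (HPI := PI_RGT_0).
  assert (H : cos_moment 2 (S n) <= cos_moment 0 n - cos_moment 0 (S n)).
  { refine (is_RInt_le _ _ _ _ _ _ _ (is_RInt_cos_moment 2 (S n))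
      (is_RInt_minus _ _ _ _ _ _ (is_RInt_cos_moment 0 n) (is_RInt_cos_moment 0 (S n))) _);
      [lra | ].
    intros x Hx.
    change (x ^ 2 * cos x ^ (2 * S n)
            <= x ^ 0 * cos x ^ (2 * n) - x ^ 0 * cos x ^ (2 * S n)).
    replace (2 * S n)%nat with (2 * n + 2)%nat by lia. rewrite !pow_add.
    assert (Hc : 0 < cos x) by (apply cos_gt_0; lra).
    assert (Hp : 0 < cos x ^ (2 * n)) by now apply pow_lt.
    assert (Hs := mul_cos_le_sin x ltac:(lra)).
    assert (E := sin2_cos2 x). unfold Rsqr in E.
    assert (Hsq : (x * cos x) * (x * cos x) <= sin x * sin x).
    { apply Rmult_le_compat; try lra; apply Rmult_le_pos; lra. }
    simpl (x ^ 0). simpl (x ^ 2). simpl (cos x ^ 2). nra. }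
  assert (E := cos_moment0_step n). assert (Hn := pos_INR n). nra.
Qed.

(** By the two recurrences, the quotients of the second moment by the zeroth
    telescope to the series of [1 / (2 (n + 1) ^ 2)]. *)
Lemma basel : hurwitz 2 1 = PI ^ 2 / 6.
Proof.
  set (u := fun n => 2 * (cos_moment 2 n / cos_moment 0 n)).
  assert (Hu : is_lim_seq u 0).
  { apply is_lim_seq_incr_1.
    apply (is_lim_seq_le_le (fun _ => 0) _ (fun n => 2 * / (1 + INR n))).
    - intros n. unfold u.
      assert (H0 := cos_moment0_pos (S n)). assert (H2 := cos_moment2_nonneg (S n)).
      assert (Hle := cos_moment2_le n). assert (Hn := pos_INR n).
      split.
      + apply Rmult_le_pos; [lra | ]. now apply Rdiv_le_0_compat.
      + apply Rmult_le_compat_l; [lra | ].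
        apply Rmult_le_reg_r with (cos_moment 0 (S n) * (1 + INR n));
          [apply Rmult_lt_0_compat; lra | ].
        replace (cos_moment 2 (S n) / cos_moment 0 (S n) * (cos_moment 0 (S n) * (1 + INR n)))
          with (cos_moment 2 (S n) * (1 + INR n)) by (field; lra).
        replace (/ (1 + INR n) * (cos_moment 0 (S n) * (1 + INR n)))
          with (cos_moment 0 (S n)) by (field; lra).
        nra.
    - apply is_lim_seq_const.
    - replace (Finite 0) with (Rbar_mult (Finite 2) (Finite 0)) by (simpl; f_equal; ring).
      apply (is_lim_seq_scal_l _ 2 0), is_lim_seq_inv_shift. lra. }
  assert (Hs := is_series_telescope u Hu).
  transitivity (u O).
  - apply is_series_unique. apply (is_series_ext (fun n => u n - u (S n))); [ | exact Hs].
    intros n. change (u n - u (S n) = / (1 + INR n) ^ 2 :> R). unfold u.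
    assert (H0 := cos_moment0_pos n). assert (H1 := cos_moment0_pos (S n)).
    assert (E0 := cos_moment0_step n). assert (E2 := cos_moment2_step n).
    assert (Hn := pos_INR n).
    assert (EJ : cos_moment 2 n = (cos_moment 0 (S n) / (INR n + 1)
              + (2 * INR n + 2) * cos_moment 2 (S n)) / (2 * INR n + 1)).
    { apply Rmult_eq_reg_r with ((INR n + 1) * (2 * INR n + 1));
        [ | apply Rgt_not_eq, Rmult_lt_0_compat; lra].
      transitivity (cos_moment 0 (S n)
                    + (INR n + 1) * (2 * INR n + 2) * cos_moment 2 (S n)).
      - lra.
      - field. lra. }
    assert (EI : cos_moment 0 n = (2 * INR n + 2) * cos_moment 0 (S n) / (2 * INR n + 1)).
    { rewrite E0. field. lra. }
    rewrite EJ, EI. field. lra.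
  - unfold u, cos_moment.
    assert (HPI := PI_RGT_0).
    assert (I0 : is_RInt (fun x => x ^ 0 * cos x ^ (2 * 0)) 0 (PI / 2) (PI / 2 - 0)).
    { apply (is_RInt_derive (fun x => x)).
      - intros x _. auto_derive; [exact I | simpl; ring].
      - intros x _. apply continuous_cos_moment. }
    assert (I2 : is_RInt (fun x => x ^ 2 * cos x ^ (2 * 0)) 0 (PI / 2)
                   ((PI / 2) ^ 3 / 3 - 0 ^ 3 / 3)).
    { apply (is_RInt_derive (fun x => x ^ 3 / 3)).
      - intros x _. auto_derive; [exact I | simpl; field].
      - intros x _. apply continuous_cos_moment. }
    rewrite (is_RInt_unique _ _ _ _ I0), (is_RInt_unique _ _ _ _ I2). field. lra.
Qed.

(** * The sign of the logarithm of the gamma function *)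

Lemma Gamma_2 : Gamma 2 = 1.
Proof.
  replace 2 with (1 + 1) by ring. rewrite Gamma_shift, Gamma_1 by lra. ring.
Qed.

(** A convex function vanishing at [1] and [2] is nonnegative outside
    [(1, 2)]. *)
Lemma log_Gamma_nonneg (a : R) : 0 < a -> a <= 1 \/ 2 <= a -> 0 <= ln (Gamma a).
Proof.
  intros Ha Hcase.
  destruct (Req_dec a 1) as [-> | N1]; [rewrite Gamma_1, ln_1; lra | ].
  destruct (Req_dec a 2) as [-> | N2]; [rewrite Gamma_2, ln_1; lra | ].
  destruct Hcase as [H | H].
  - (* [1] lies between [a] and [2] *)
    assert (Hl : 0 < / (2 - a) <= 1).
    { split; [apply Rinv_0_lt_compat; lra | ].
      rewrite <- Rinv_1. apply Rinv_le_contravar; lra. }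
    assert (Hc := log_Gamma_convex a 2 (/ (2 - a)) Ha ltac:(lra) ltac:(lra)).
    simpl in Hc.
    replace (/ (2 - a) * a + (1 - / (2 - a)) * 2) with 1 in Hc by (field; lra).
    rewrite Gamma_1, Gamma_2, ln_1 in Hc. nra.
  - (* [2] lies between [1] and [a] *)
    assert (Hl : 0 < / (a - 1) <= 1).
    { split; [apply Rinv_0_lt_compat; lra | ].
      rewrite <- Rinv_1. apply Rinv_le_contravar; lra. }
    assert (Hc := log_Gamma_convex a 1 (/ (a - 1)) Ha ltac:(lra) ltac:(lra)).
    simpl in Hc.
    replace (/ (a - 1) * a + (1 - / (a - 1)) * 1) with 2 in Hc by (field; lra).
    rewrite Gamma_1, Gamma_2, ln_1 in Hc. nra.
Qed.

Lemma digamma_incr (x y : R) : 0 < x < y -> digamma x < digamma y.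
Proof.
  intros Hxy. apply (derive_pos_lt digamma (hurwitz 2)); [lra | | ].
  - intros t Ht. apply is_derive_digamma. lra.
  - intros t Ht. apply hurwitz_pos; [lra | lia].
Qed.

(** Otherwise the mean value theorem would give a point of [(1, a)] with
    [digamma] nonnegative and one of [(a, 2)] with [digamma] nonpositive. *)
Lemma log_Gamma_neg (a : R) : 1 < a < 2 -> ln (Gamma a) < 0.
Proof.
  intros Ha.
  destruct (mean_value (fun t => ln (Gamma t)) digamma 1 a) as [s [Hs Es]];
    [lra | intros; apply is_derive_log_Gamma; lra | ].
  destruct (mean_value (fun t => ln (Gamma t)) digamma a 2) as [t [Ht Et]];
    [lra | intros; apply is_derive_log_Gamma; lra | ].
  simpl in Es, Et. rewrite Gamma_1, ln_1 in Es. rewrite Gamma_2, ln_1 in Et.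
  assert (H := digamma_incr s t ltac:(lra)).
  apply Rnot_le_lt. intros H0.
  assert (0 <= digamma s).
  { apply Rmult_le_reg_r with (a - 1); lra. }
  assert (digamma t <= 0).
  { apply Rmult_le_reg_r with (2 - a); lra. }
  lra.
Qed.

(** * The auxiliary functions *)

(** The numerator of the derivative of [ln (Gamma (x + a)) / x]. *)
Definition root_slope (a x : R) : R :=
  x * digamma (x + a) - ln (Gamma (x + a)).

(** The numerator of [Derive (h4 a)]; see [is_derive_h4]. *)
Definition h4_slope (a x : R) : R :=
  x ^ 2 * (x + a) * hurwitz 2 (x + a) - (x + 2 * a) * root_slope a x.

Definition h4_slope' (a x : R) : R :=
  - (2 * (x ^ 2 * (x + a))) * hurwitz 3 (x + a)
  + 2 * x ^ 2 * hurwitz 2 (x + a) - root_slope a x.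

(** Its sign is that of the derivative of [root_slope a x / x], the
    logarithmic derivative of [g3 a 0] with respect to [ln x]. *)
Definition elasticity_slope (a x : R) : R :=
  x ^ 2 * hurwitz 2 (x + a) - root_slope a x.

Lemma is_derive_shift (f : R -> R) (a x l : R) :
  is_derive f (x + a) l -> is_derive (fun t => f (t + a)) x l.
Proof.
  intros Hf. replace l with (1 * l) by ring.
  apply (is_derive_comp f (fun t => t + a)); [exact Hf | ].
  auto_derive; [exact I | ring].
Qed.

Lemma is_derive_hurwitz_shift (k : nat) (a x : R) :
  0 < x + a -> (2 <= k)%nat ->
  is_derive (fun t => hurwitz k (t + a)) x (- INR k * hurwitz (S k) (x + a)).
Proof. intros Hx Hk. now apply is_derive_shift, is_derive_hurwitz. Qed.

Lemma is_derive_prod (f g : R -> R) (x df dg : R) :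
  is_derive f x df -> is_derive g x dg ->
  is_derive (fun t => f t * g t) x (df * g x + f x * dg).
Proof.
  intros Hf Hg. apply (is_derive_mult f g x df dg Hf Hg). intros; apply Rmult_comm.
Qed.

Lemma root_slope_0 (a : R) : root_slope a 0 = - ln (Gamma a).
Proof. unfold root_slope. rewrite Rplus_0_l. ring. Qed.

Lemma is_derive_root_slope (a x : R) :
  0 < x + a -> is_derive (root_slope a) x (x * hurwitz 2 (x + a)).
Proof.
  intros Hx.
  replace (x * hurwitz 2 (x + a))
    with (1 * digamma (x + a) + x * hurwitz 2 (x + a) - digamma (x + a)) by ring.
  apply (is_derive_minus (fun t => t * digamma (t + a)) (fun t => ln (Gamma (t + a)))).
  - apply (is_derive_prod (fun t => t) (fun t => digamma (t + a))).
    + auto_derive; [exact I | reflexivity].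
    + now apply is_derive_shift, is_derive_digamma.
  - now apply (is_derive_shift (fun t => ln (Gamma t))), is_derive_log_Gamma.
Qed.

Lemma is_derive_h4_slope (a x : R) :
  0 < x + a -> is_derive (h4_slope a) x (h4_slope' a x).
Proof.
  intros Hx. unfold h4_slope'.
  replace (_ + _ - _) with
    ((2 * x * (x + a) + x ^ 2) * hurwitz 2 (x + a)
     + x ^ 2 * (x + a) * (- INR 2 * hurwitz 3 (x + a))
     - (1 * root_slope a x + (x + 2 * a) * (x * hurwitz 2 (x + a))))
    by (unfold root_slope; simpl INR; ring).
  apply (is_derive_minus (fun t => t ^ 2 * (t + a) * hurwitz 2 (t + a))
           (fun t => (t + 2 * a) * root_slope a t)).
  - apply (is_derive_prod (fun t => t ^ 2 * (t + a)) (fun t => hurwitz 2 (t + a))).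
    + auto_derive; [exact I | ring].
    + now apply is_derive_hurwitz_shift.
  - apply (is_derive_prod (fun t => t + 2 * a) (root_slope a)).
    + auto_derive; [exact I | ring].
    + now apply is_derive_root_slope.
Qed.

Lemma is_derive_h4_slope' (a x : R) :
  0 < x + a ->
  is_derive (h4_slope' a) x
    (x * (6 * x * (x + a) * hurwitz 4 (x + a)
          - 2 * (5 * x + 2 * a) * hurwitz 3 (x + a) + 3 * hurwitz 2 (x + a))).
Proof.
  intros Hx.
  replace (x * _) with
    ((- (4 * x * (x + a) + 2 * x ^ 2) * hurwitz 3 (x + a)
      + - (2 * (x ^ 2 * (x + a))) * (- INR 3 * hurwitz 4 (x + a)))
     + (4 * x * hurwitz 2 (x + a) + 2 * x ^ 2 * (- INR 2 * hurwitz 3 (x + a)))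
     - x * hurwitz 2 (x + a)) by (simpl INR; ring).
  apply (is_derive_minus (fun t => - (2 * (t ^ 2 * (t + a))) * hurwitz 3 (t + a)
           + 2 * t ^ 2 * hurwitz 2 (t + a)) (root_slope a));
    [ | now apply is_derive_root_slope].
  apply (is_derive_plus (fun t => - (2 * (t ^ 2 * (t + a))) * hurwitz 3 (t + a))
           (fun t => 2 * t ^ 2 * hurwitz 2 (t + a))).
  - apply (is_derive_prod (fun t => - (2 * (t ^ 2 * (t + a)))) (fun t => hurwitz 3 (t + a))).
    + auto_derive; [exact I | ring].
    + apply is_derive_hurwitz_shift; [exact Hx | lia].
  - apply (is_derive_prod (fun t => 2 * t ^ 2) (fun t => hurwitz 2 (t + a))).
    + auto_derive; [exact I | ring].
    + now apply is_derive_hurwitz_shift.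
Qed.

Lemma is_derive_elasticity_slope (a x : R) :
  0 < x + a ->
  is_derive (elasticity_slope a) x
    (x * (hurwitz 2 (x + a) - 2 * x * hurwitz 3 (x + a))).
Proof.
  intros Hx.
  replace (x * _) with
    ((2 * x * hurwitz 2 (x + a) + x ^ 2 * (- INR 2 * hurwitz 3 (x + a)))
     - x * hurwitz 2 (x + a)) by (simpl INR; ring).
  apply (is_derive_minus (fun t => t ^ 2 * hurwitz 2 (t + a)) (root_slope a));
    [ | now apply is_derive_root_slope].
  apply (is_derive_prod (fun t => t ^ 2) (fun t => hurwitz 2 (t + a))).
  - auto_derive; [exact I | ring].
  - now apply is_derive_hurwitz_shift.
Qed.

Lemma h4_root_slope (a x : R) : h4 a x = (x + a) * root_slope a x / x ^ 2.
Proof. unfold h4, root_slope. f_equal. ring. Qed.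

Lemma is_derive_h4 (a x : R) :
  0 < a -> 0 < x -> is_derive (h4 a) x (h4_slope a x / x ^ 3).
Proof.
  intros Ha Hx.
  apply (is_derive_ext (fun t => (t + a) / t ^ 2 * root_slope a t)).
  { intros t. change ((t + a) / t ^ 2 * root_slope a t = h4 a t).
    rewrite h4_root_slope. unfold Rdiv. ring. }
  replace (h4_slope a x / x ^ 3)
    with ((- (x + 2 * a) / x ^ 3) * root_slope a x
          + (x + a) / x ^ 2 * (x * hurwitz 2 (x + a)))
    by (unfold h4_slope; field; lra).
  apply (is_derive_prod (fun t => (t + a) / t ^ 2) (root_slope a)).
  - auto_derive; [nra | field; lra].
  - apply is_derive_root_slope. lra.
Qed.

Definition log_g3 (a c x : R) : R := ln (Gamma (x + a)) / x - c * ln (x + a).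

Lemma g3_exp (a c x : R) : g3 a c x = exp (log_g3 a c x).
Proof.
  unfold g3, log_g3, Rpower, Rminus. rewrite exp_plus, exp_Ropp.
  unfold Rdiv. do 2 f_equal. ring.
Qed.

Lemma is_derive_log_g3 (a c x : R) :
  0 < a -> 0 < x -> is_derive (log_g3 a c) x ((h4 a x - c) / (x + a)).
Proof.
  intros Ha Hx.
  replace ((h4 a x - c) / (x + a))
    with (digamma (x + a) * / x + ln (Gamma (x + a)) * (- / x ^ 2) - c / (x + a))
    by (rewrite h4_root_slope; unfold root_slope; field; lra).
  apply (is_derive_minus (fun t => ln (Gamma (t + a)) * / t) (fun t => c * ln (t + a))).
  - apply (is_derive_prod (fun t => ln (Gamma (t + a))) (fun t => / t)).
    + apply (is_derive_shift (fun t => ln (Gamma t))), is_derive_log_Gamma. lra.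
    + auto_derive; [lra | field; lra].
  - auto_derive; [lra | field; lra].
Qed.

(** * Monotonicity of [g3] *)

Lemma derive_nonneg_of_incr (f : R -> R) (x l : R) :
  is_derive f x l -> (forall t, x < t -> f x <= f t) -> 0 <= l.
Proof.
  intros Hf Hincr. apply Rnot_lt_le. intros Hl.
  apply is_derive_Reals in Hf.
  destruct (Hf (- l) ltac:(lra)) as [[d Hd] Hq]. simpl in Hq.
  specialize (Hq (d / 2) ltac:(lra)).
  rewrite Rabs_right in Hq by lra. specialize (Hq ltac:(lra)).
  apply Rabs_def2 in Hq.
  specialize (Hincr (x + d / 2) ltac:(lra)).
  assert (0 <= (f (x + d / 2) - f x) / (d / 2)).
  { apply Rdiv_le_0_compat; lra. }
  lra.
Qed.

Lemma h4_lower_of_g3_incr (a c : R) :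
  0 < a -> strictly_increasing_on positive_half_line (g3 a c) ->
  forall x, 0 < x -> c <= h4 a x.
Proof.
  intros Ha Hincr x Hx.
  assert (H : 0 <= (h4 a x - c) / (x + a)).
  { apply (derive_nonneg_of_incr (log_g3 a c) x); [now apply is_derive_log_g3 | ].
    intros t Ht. left. apply exp_lt_inv. rewrite <- !g3_exp.
    apply Hincr; unfold positive_half_line; lra. }
  assert (E : (h4 a x - c) / (x + a) * (x + a) = h4 a x - c) by (field; lra).
  nra.
Qed.

Lemma h4_upper_of_g3_decr (a c : R) :
  0 < a -> strictly_decreasing_on positive_half_line (g3 a c) ->
  forall x, 0 < x -> h4 a x <= c.
Proof.
  intros Ha Hdecr x Hx.
  assert (H : 0 <= - ((h4 a x - c) / (x + a))).
  { apply (derive_nonneg_of_incr (fun t => - log_g3 a c t) x).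
    - apply (is_derive_opp (log_g3 a c)). now apply is_derive_log_g3.
    - intros t Ht. left. apply Ropp_lt_contravar, exp_lt_inv. rewrite <- !g3_exp.
      apply Hdecr; unfold positive_half_line; lra. }
  assert (E : (h4 a x - c) / (x + a) * (x + a) = h4 a x - c) by (field; lra).
  nra.
Qed.

Lemma g3_lt (a c x y : R) :
  0 < a -> 0 < x < y -> (forall t, x < t < y -> c < h4 a t) -> g3 a c x < g3 a c y.
Proof.
  intros Ha Hxy Hc. rewrite !g3_exp. apply exp_increasing.
  apply (derive_pos_lt (log_g3 a c) (fun t => (h4 a t - c) / (t + a))); [lra | | ].
  - intros t Ht. apply is_derive_log_g3; lra.
  - intros t Ht. specialize (Hc t Ht). apply Rdiv_lt_0_compat; lra.
Qed.

Lemma g3_gt (a c x y : R) :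
  0 < a -> 0 < x < y -> (forall t, x < t < y -> h4 a t < c) -> g3 a c y < g3 a c x.
Proof.
  intros Ha Hxy Hc. rewrite !g3_exp. apply exp_increasing, Ropp_lt_cancel.
  apply (derive_pos_lt (fun t => - log_g3 a c t)
           (fun t => - ((h4 a t - c) / (t + a)))); [lra | | ].
  - intros t Ht. apply (is_derive_opp (log_g3 a c)), is_derive_log_g3; lra.
  - intros t Ht. specialize (Hc t Ht).
    replace (- ((h4 a t - c) / (t + a))) with ((c - h4 a t) / (t + a)) by (field; lra).
    apply Rdiv_lt_0_compat; lra.
Qed.

(** [x ^ 2 / (x + a)] and [root_slope a x] have derivatives
    [x * (1 / y + a / y ^ 2)] and [x * hurwitz 2 y], where [y = x + a], and
    [hurwitz 2 y <= 1 / y + 1 / y ^ 2]. *)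
Lemma h4_lt_1 (a x : R) : 2 <= a -> 0 < x -> h4 a x < 1.
Proof.
  intros Ha Hx.
  assert (HL := log_Gamma_nonneg a ltac:(lra) ltac:(lra)).
  assert (H : 0 ^ 2 / (0 + a) - root_slope a 0 < x ^ 2 / (x + a) - root_slope a x).
  { apply (derive_pos_lt (fun t => t ^ 2 / (t + a) - root_slope a t)
      (fun t => t * (/ (t + a) + a / (t + a) ^ 2) - t * hurwitz 2 (t + a))); [lra | | ].
    - intros t Ht. apply (is_derive_minus (fun t => t ^ 2 / (t + a)) (root_slope a)).
      + auto_derive; [lra | field; lra].
      + apply is_derive_root_slope. lra.
    - intros t Ht. assert (HU := hurwitz2_upper (t + a) ltac:(lra)).
      assert (Hp : 0 < / (t + a) ^ 2) by (apply Rinv_0_lt_compat, pow_lt; lra).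
      unfold Rdiv. rewrite <- Rmult_minus_distr_l.
      apply Rmult_lt_0_compat; nra. }
  rewrite root_slope_0, h4_root_slope in *.
  replace (0 ^ 2 / (0 + a)) with 0 in H by (field; lra).
  apply Rmult_lt_reg_r with (x ^ 2 / (x + a));
    [apply Rdiv_lt_0_compat; nra | ].
  replace ((x + a) * root_slope a x / x ^ 2 * (x ^ 2 / (x + a)))
    with (root_slope a x) by (field; lra).
  lra.
Qed.

(** If [c < 1] were an upper bound then [root_slope a x - c * x ^ 2 / (x + a)]
    would stay nonpositive, but its slope tends to [1 - c]. *)
Lemma one_le_h4_upper_bound (a c : R) :
  0 < a -> (forall x, 0 < x -> h4 a x <= c) -> 1 <= c.
Proof.
  intros Ha Hub. apply Rnot_lt_le. intros Hc.
  set (X := a + 2 * Rabs c * a / (1 - c)).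
  assert (HX : a <= X).
  { assert (0 <= 2 * Rabs c * a / (1 - c)); [ | unfold X; lra].
    apply Rdiv_le_0_compat; [ | lra]. assert (H := Rabs_pos c). nra. }
  destruct (linear_growth_pos (fun t => root_slope a t - c * (t ^ 2 / (t + a)))
    (fun t => t * hurwitz 2 (t + a) - c * (t * (/ (t + a) + a / (t + a) ^ 2)))
    X ((1 - c) / 4)) as [x [Hx Hpos]]; [lra | | | ].
  - intros t Ht.
    apply (is_derive_minus (root_slope a) (fun t => c * (t ^ 2 / (t + a)))).
    + apply is_derive_root_slope. lra.
    + auto_derive; [lra | field; lra].
  - intros t Ht.
    assert (HH := hurwitz2_lower_inv (t + a) ltac:(lra)).
    assert (Hca : Rabs c * a / (t + a) <= (1 - c) / 2).
    { apply Rmult_le_reg_r with (t + a); [lra | ].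
      replace (Rabs c * a / (t + a) * (t + a)) with (Rabs c * a) by (field; lra).
      assert (E : 2 * Rabs c * a / (1 - c) * (1 - c) = 2 * Rabs c * a) by (field; lra).
      unfold X in Ht. nra. }
    assert (Hcc : c * (a / (t + a)) <= Rabs c * a / (t + a)).
    { unfold Rdiv. rewrite Rmult_assoc. apply Rmult_le_compat_r.
      - apply Rmult_le_pos; [lra | left; apply Rinv_0_lt_compat; lra].
      - apply Rle_abs. }
    assert (Hta : 1 / 2 <= t / (t + a)).
    { apply Rmult_le_reg_r with (t + a); [lra | ].
      replace (t / (t + a) * (t + a)) with t by (field; lra). lra. }
    apply Rle_trans with (t / (t + a) * (1 - c - c * (a / (t + a)))); [nra | ].
    replace (t / (t + a) * (1 - c - c * (a / (t + a))))
      with (t * / (t + a) - c * (t * (/ (t + a) + a / (t + a) ^ 2))) by (field; lra).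
    apply Rplus_le_compat_r, Rmult_le_compat_l; lra.
  - specialize (Hub x ltac:(lra)). rewrite h4_root_slope in Hub.
    assert (Hp : 0 < x ^ 2 / (x + a)).
    { apply Rdiv_lt_0_compat; [apply pow_lt; lra | lra]. }
    apply (Rmult_le_compat_r (x ^ 2 / (x + a))) in Hub; [ | lra].
    replace ((x + a) * root_slope a x / x ^ 2 * (x ^ 2 / (x + a)))
      with (root_slope a x) in Hub by (field; lra).
    lra.
Qed.

(** The bounds on [hurwitz 2], [hurwitz 3] and [hurwitz 4] reduce the bracket
    to a rational function of [y = x + a] with leading term
    [(a - 1 / 2) / y ^ 2]. The part [1 / (10 * y ^ 2)] of that term can be spared:
    the rest still outweighs the lower-order terms when [y >= a >= 13 / 10]. *)
Lemma h4_slope''_lower (a x : R) :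
  13 / 10 <= a -> 0 < x ->
  / 10 * x / (x + a) ^ 2 <=
  x * (6 * x * (x + a) * hurwitz 4 (x + a)
       - 2 * (5 * x + 2 * a) * hurwitz 3 (x + a) + 3 * hurwitz 2 (x + a)).
Proof.
  intros Ha Hx.
  assert (H2 := hurwitz2_lower (x + a) ltac:(lra)).
  assert (H3 := hurwitz3_upper (x + a) ltac:(lra)).
  assert (H4 := hurwitz4_lower (x + a) ltac:(lra)).
  unfold Rdiv. rewrite (Rmult_comm (/ 10)), !Rmult_assoc.
  apply Rmult_le_compat_l; [lra | ].
  apply (Rmult_le_compat_l (x * (x + a))) in H4; [ | nra].
  apply (Rmult_le_compat_l (5 * x + 2 * a)) in H3; [ | nra].
  set (y := x + a) in *.
  assert (Hy : 13 / 10 <= y) by (unfold y; lra).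
  apply Rle_trans with
    (x * y * (2 / y ^ 3 + 3 / y ^ 4 + 2 / y ^ 5 - / y ^ 7)
     - (5 * x + 2 * a) * (/ y ^ 2 + / y ^ 3 + / (2 * y ^ 4))
     + 3 * (/ y + / (2 * y ^ 2) + / (6 * y ^ 3) - / (30 * y ^ 5))); [ | nra].
  apply Rminus_le_0.
  replace x with (y - a) by (unfold y; ring).
  replace (_ - / 10 * / y ^ 2)
    with (((a - 6 / 10) * y ^ 4 - a / 2 * y ^ 2 - 11 / 10 * y + a) / y ^ 6)
    by (field; lra).
  apply Rdiv_le_0_compat; [ | apply pow_lt; lra].
  (* the numerator increases with [a]; take [a = 13 / 10], then [y ^ 4 >= (169 / 100) * y ^ 2] *)
  replace ((a - 6 / 10) * y ^ 4 - a / 2 * y ^ 2 - 11 / 10 * y + a)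
    with ((a - 13 / 10) * (y ^ 4 - y ^ 2 / 2 + 1)
          + (7 / 10 * y ^ 2 * (y ^ 2 - 169 / 100)
             + (533 / 1000 * y ^ 2 - 11 / 10 * y + 13 / 10))) by field.
  assert (Hy2 : 169 / 100 <= y ^ 2) by nra.
  assert (0 <= y ^ 4 - y ^ 2 / 2 + 1).
  { replace (y ^ 4) with (y ^ 2 * y ^ 2) by ring. nra. }
  assert (0 <= 533 / 1000 * y ^ 2 - 11 / 10 * y + 13 / 10).
  { assert (0 <= (y - 1) ^ 2) by apply pow2_ge_0. nra. }
  apply Rplus_le_le_0_compat; [apply Rmult_le_pos; lra | ].
  apply Rplus_le_le_0_compat; [apply Rmult_le_pos; lra | assumption].
Qed.

Lemma h4_slope'_incr (a x y : R) :
  13 / 10 <= a -> 0 <= x < y -> h4_slope' a x < h4_slope' a y.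
Proof.
  intros Ha Hxy.
  apply (derive_pos_lt (h4_slope' a) (fun x =>
    x * (6 * x * (x + a) * hurwitz 4 (x + a)
       - 2 * (5 * x + 2 * a) * hurwitz 3 (x + a) + 3 * hurwitz 2 (x + a)))); [lra | | ].
  - intros t Ht. apply is_derive_h4_slope'. lra.
  - intros t Ht. apply Rlt_le_trans with (2 := h4_slope''_lower a t Ha ltac:(lra)).
    apply Rdiv_lt_0_compat; [lra | apply pow_lt; lra].
Qed.

Lemma h4_slope_0 (a : R) : h4_slope a 0 = 2 * a * ln (Gamma a).
Proof. unfold h4_slope. rewrite root_slope_0. ring. Qed.

Lemma h4_slope'_0 (a : R) : h4_slope' a 0 = ln (Gamma a).
Proof. unfold h4_slope'. rewrite root_slope_0. ring. Qed.

Lemma h4_slope_eventually_pos (a : R) :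
  13 / 10 <= a -> exists X, 0 < X /\ 0 < h4_slope a X.
Proof.
  intros Ha.
  destruct (log_growth_unbounded (h4_slope' a) (fun x =>
    x * (6 * x * (x + a) * hurwitz 4 (x + a)
       - 2 * (5 * x + 2 * a) * hurwitz 3 (x + a) + 3 * hurwitz 2 (x + a)))
    a (/ 10) 1) as [X [HX Hbig]]; [lra | lra | | | ].
  - intros t Ht. apply is_derive_h4_slope'. lra.
  - intros t Ht. now apply h4_slope''_lower.
  - destruct (linear_growth_pos (h4_slope a) (h4_slope' a) X 1) as [x [Hx Hp]]; [lra | | | ].
    + intros t Ht. apply is_derive_h4_slope. lra.
    + intros t Ht. left. now apply Hbig.
    + exists x. split; [lra | exact Hp].
Qed.

Lemma h4_slope_2_pos (x : R) : 0 < x -> 0 < h4_slope 2 x.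
Proof.
  intros Hx.
  replace 0 with (h4_slope 2 0) by (rewrite h4_slope_0, Gamma_2, ln_1; ring).
  apply (derive_pos_lt (h4_slope 2) (h4_slope' 2)); [exact Hx | | ].
  - intros t Ht. apply is_derive_h4_slope. lra.
  - intros t Ht. replace 0 with (h4_slope' 2 0) by (rewrite h4_slope'_0, Gamma_2; apply ln_1).
    apply h4_slope'_incr; lra.
Qed.

Lemma h4_2_incr (x y : R) : 0 < x < y -> h4 2 x < h4 2 y.
Proof.
  intros Hxy. apply (derive_pos_lt (h4 2) (fun t => h4_slope 2 t / t ^ 3)); [lra | | ].
  - intros t Ht. apply is_derive_h4; lra.
  - intros t Ht. apply Rdiv_lt_0_compat; [apply h4_slope_2_pos; lra | apply pow_lt; lra].
Qed.

(** [root_slope 2] vanishes at [0] and has derivative [t * hurwitz 2 (t + 2)],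
    where the second factor decreases with [t]. *)
Lemma root_slope_2_bounds (x : R) :
  0 < x -> x ^ 2 / 2 * hurwitz 2 (x + 2) <= root_slope 2 x <= x ^ 2 / 2 * hurwitz 2 2.
Proof.
  intros Hx.
  assert (E0 : root_slope 2 0 = 0) by (rewrite root_slope_0, Gamma_2, ln_1; ring).
  assert (Hd : forall k t, 0 <= t ->
    is_derive (fun t => root_slope 2 t - t ^ 2 / 2 * k) t (t * (hurwitz 2 (t + 2) - k))).
  { intros k t Ht. replace (t * (hurwitz 2 (t + 2) - k))
      with (t * hurwitz 2 (t + 2) - t * k) by ring.
    apply (is_derive_minus (root_slope 2) (fun t => t ^ 2 / 2 * k)).
    - apply is_derive_root_slope. lra.
    - auto_derive; [exact I | field]. }
  split.
  - set (k := hurwitz 2 (x + 2)).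
    assert (H : root_slope 2 0 - 0 ^ 2 / 2 * k <= root_slope 2 x - x ^ 2 / 2 * k); [ | lra].
    apply (derive_nonneg_le (fun t => root_slope 2 t - t ^ 2 / 2 * k)
             (fun t => t * (hurwitz 2 (t + 2) - k))); [lra | | ].
    + intros t Ht. apply Hd. lra.
    + intros t Ht. apply Rmult_le_pos; [lra | ].
      assert (k <= hurwitz 2 (t + 2)) by (apply hurwitz_decr; [lra | lia]). lra.
  - set (k := hurwitz 2 2).
    assert (H : - (root_slope 2 0 - 0 ^ 2 / 2 * k) <= - (root_slope 2 x - x ^ 2 / 2 * k));
      [ | lra].
    apply (derive_nonneg_le (fun t => - (root_slope 2 t - t ^ 2 / 2 * k))
             (fun t => - (t * (hurwitz 2 (t + 2) - k)))); [lra | | ].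
    + intros t Ht. apply (is_derive_opp (fun t => root_slope 2 t - t ^ 2 / 2 * k)).
      apply Hd. lra.
    + intros t Ht.
      assert (hurwitz 2 (t + 2) <= k) by (apply hurwitz_decr; [lra | lia]). nra.
Qed.

Lemma h4_2_bounds (x : R) :
  0 < x -> hurwitz 2 (x + 2) <= h4 2 x <= (1 + x / 2) * hurwitz 2 2.
Proof.
  intros Hx. destruct (root_slope_2_bounds x Hx) as [H1 H2].
  assert (Hp := hurwitz_pos 2 (x + 2) ltac:(lra) ltac:(lia)).
  assert (Hk : 0 < (x + 2) / x ^ 2) by (apply Rdiv_lt_0_compat; [lra | apply pow_lt; lra]).
  apply (Rmult_le_compat_l ((x + 2) / x ^ 2)) in H1; [ | lra].
  apply (Rmult_le_compat_l ((x + 2) / x ^ 2)) in H2; [ | lra].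
  rewrite h4_root_slope.
  replace ((x + 2) * root_slope 2 x / x ^ 2)
    with ((x + 2) / x ^ 2 * root_slope 2 x) by (unfold Rdiv; ring).
  replace ((x + 2) / x ^ 2 * (x ^ 2 / 2 * hurwitz 2 (x + 2)))
    with ((1 + x / 2) * hurwitz 2 (x + 2)) in H1 by (field; lra).
  replace ((x + 2) / x ^ 2 * (x ^ 2 / 2 * hurwitz 2 2))
    with ((1 + x / 2) * hurwitz 2 2) in H2 by (field; lra).
  split; [nra | exact H2].
Qed.

Lemma hurwitz_2_2 : hurwitz 2 2 = PI ^ 2 / 6 - 1.
Proof.
  replace 2 with (1 + 1) at 1 by ring.
  rewrite hurwitz_shift by (lra || lia). rewrite basel. field.
Qed.

(** [h4 2] increases from its limit [hurwitz 2 2] at [0]. *)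
Lemma h4_2_lower_bounds (c : R) :
  (forall x, 0 < x -> c <= h4 2 x) <-> c <= hurwitz 2 2.
Proof.
  split.
  - intros Hc. set (k := hurwitz 2 2).
    replace c with (c - 0 / 2 * k) by field.
    apply (le_of_forall_right (fun t => c - t / 2 * k) k 1); [ | lra | ].
    + apply (ex_derive_continuous (fun t => c - t / 2 * k) 0). now auto_derive.
    + intros t Ht. specialize (Hc t ltac:(lra)).
      assert (H := proj2 (h4_2_bounds t ltac:(lra))). fold k in H. lra.
  - intros Hc x Hx. apply Rle_trans with (1 := Hc).
    replace (hurwitz 2 2) with (hurwitz 2 (0 + 2)) by (f_equal; ring).
    apply (le_of_forall_right (fun t => hurwitz 2 (t + 2)) (h4 2 x) x); [ | exact Hx | ].
    + apply (ex_derive_continuous (fun t => hurwitz 2 (t + 2)) 0).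
      eexists. apply is_derive_hurwitz_shift; [lra | lia].
    + intros t Ht.
      apply Rle_trans with (1 := proj1 (h4_2_bounds t ltac:(lra))).
      left. apply h4_2_incr. lra.
Qed.

(** [h4_slope a] is strictly convex and negative at [0], so it changes sign
    exactly once; there [h4 a] has its minimum. *)
Lemma h4_minimum (a : R) :
  13 / 10 <= a < 2 ->
  exists z, 0 < z /\ h4_slope a z = 0 /\
    forall x, 0 < x -> x <> z -> h4 a z < h4 a x.
Proof.
  intros Ha.
  assert (H0 : h4_slope a 0 < 0).
  { rewrite h4_slope_0. assert (H := log_Gamma_neg a ltac:(lra)). nra. }
  assert (Hd : forall t, 0 <= t -> is_derive (h4_slope a) t (h4_slope' a t)).
  { intros t Ht. apply is_derive_h4_slope. lra. }
  destruct (h4_slope_eventually_pos a ltac:(lra)) as [X [HX HpX]].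
  destruct (intermediate_zero (h4_slope a) (h4_slope' a) 0 X) as [z [Hz Ez]];
    [exact HX | intros; apply Hd; lra | exact H0 | exact HpX | ].
  exists z. split; [lra | ]. split; [exact Ez | ].
  assert (Hright : forall x, z < x -> 0 < h4_slope a x).
  { intros x Hx. rewrite <- Ez.
    destruct (mean_value (h4_slope a) (h4_slope' a) 0 z) as [s [Hs Es]];
      [lra | intros; apply Hd; lra | ].
    assert (Hps : 0 < h4_slope' a s) by nra.
    apply (derive_pos_lt (h4_slope a) (h4_slope' a)); [exact Hx | intros; apply Hd; lra | ].
    intros t Ht. apply Rlt_trans with (1 := Hps). apply h4_slope'_incr; lra. }
  assert (Hleft : forall x, 0 < x < z -> h4_slope a x < 0).
  { intros x Hx. apply Rnot_le_lt. intros Hge.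
    destruct (mean_value (h4_slope a) (h4_slope' a) 0 x) as [s [Hs Es]];
      [lra | intros; apply Hd; lra | ].
    destruct (mean_value (h4_slope a) (h4_slope' a) x z) as [t [Ht Et]];
      [lra | intros; apply Hd; lra | ].
    assert (Hst := h4_slope'_incr a s t ltac:(lra) ltac:(lra)).
    assert (0 < h4_slope' a s) by nra. nra. }
  intros x Hx Hne.
  destruct (Rtotal_order x z) as [Hlt | [Heq | Hgt]]; [ | contradiction | ].
  - apply Ropp_lt_cancel.
    apply (derive_pos_lt (fun t => - h4 a t) (fun t => - (h4_slope a t / t ^ 3)));
      [exact Hlt | | ].
    + intros t Ht. apply (is_derive_opp (h4 a)), is_derive_h4; lra.
    + intros t Ht. specialize (Hleft t ltac:(lra)).
      replace (- (h4_slope a t / t ^ 3)) with (- h4_slope a t / t ^ 3) by (field; lra).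
      apply Rdiv_lt_0_compat; [lra | apply pow_lt; lra].
  - apply (derive_pos_lt (h4 a) (fun t => h4_slope a t / t ^ 3)); [exact Hgt | | ].
    + intros t Ht. apply is_derive_h4; lra.
    + intros t Ht. apply Rdiv_lt_0_compat; [apply Hright; lra | apply pow_lt; lra].
Qed.

(** * Geometric convexity of [g3] *)

(** A function of [ln x] is convex when its derivative [x * f' x] with respect
    to [ln x] is nondecreasing. *)
Lemma log_convex_midpoint (I : R -> Prop) (f f' : R -> R) :
  positive_interval I ->
  (forall x, I x -> is_derive f x (f' x)) ->
  (forall x y, I x -> I y -> x <= y -> x * f' x <= y * f' y) ->
  forall x y, I x -> I y -> I (sqrt (x * y)) /\ f (sqrt (x * y)) <= (f x + f y) / 2.
Proof.
  intros [Hpos Hint] Hf Hmono.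
  (* as a function of [ln x], [f] lies above its tangents *)
  assert (Htan : forall m x, I m -> I x -> f m + m * f' m * (ln x - ln m) <= f x).
  { intros m x Hm Hx. assert (Hm0 := Hpos m Hm). assert (Hx0 := Hpos x Hx).
    set (k := m * f' m).
    assert (Hd : forall t, I t -> is_derive (fun t => f t - k * ln t) t (f' t - k / t)).
    { intros t Ht. assert (Ht0 := Hpos t Ht).
      apply (is_derive_minus f (fun t => k * ln t)); [now apply Hf | ].
      auto_derive; [exact Ht0 | field; lra]. }
    assert (Hs : forall t, I t -> t * (f' t - k / t) = t * f' t - k).
    { intros t Ht. assert (Ht0 := Hpos t Ht). field. lra. }
    destruct (Rle_dec m x) as [Hle | Hgt].
    - assert (H : f m - k * ln m <= f x - k * ln x); [ | lra].
      apply (derive_nonneg_le (fun t => f t - k * ln t) (fun t => f' t - k / t));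
        [exact Hle | | ].
      + intros t Ht. apply Hd, (Hint m x); auto.
      + intros t Ht. assert (It : I t) by (apply (Hint m x); auto; lra).
        assert (H1 := Hmono m t Hm It ltac:(lra)). assert (H2 := Hs t It).
        fold k in H1. apply Rmult_le_reg_l with t; lra.
    - assert (H : - (f x - k * ln x) <= - (f m - k * ln m)); [ | lra].
      apply (derive_nonneg_le (fun t => - (f t - k * ln t)) (fun t => - (f' t - k / t)));
        [lra | | ].
      + intros t Ht. apply (is_derive_opp (fun t => f t - k * ln t)).
        apply Hd, (Hint x m); auto.
      + intros t Ht. assert (It : I t) by (apply (Hint x m); auto; lra).
        assert (H1 := Hmono t m It Hm ltac:(lra)). assert (H2 := Hs t It).
        fold k in H1. apply Rmult_le_reg_l with t; lra. }
  intros x y Hx Hy. assert (Hx0 := Hpos x Hx). assert (Hy0 := Hpos y Hy).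
  set (m := sqrt (x * y)).
  assert (Hm0 : 0 < m) by (apply sqrt_lt_R0; nra).
  assert (Hmm : m * m = x * y) by (apply sqrt_sqrt; nra).
  assert (Im : I m).
  { destruct (Rle_dec x y); [apply (Hint x y) | apply (Hint y x)]; auto; split; nra. }
  split; [exact Im | ].
  assert (Hln : ln x + ln y = ln m + ln m) by (rewrite <- !ln_mult by assumption; now f_equal).
  assert (Tx := Htan m x Im Hx). assert (Ty := Htan m y Im Hy).
  replace (ln y) with (ln m + ln m - ln x) in Ty by lra.
  lra.
Qed.

Lemma exp_half_sum (p q : R) : exp ((p + q) / 2) = sqrt (exp p * exp q).
Proof.
  symmetry. apply sqrt_lem_1.
  - left. apply Rmult_lt_0_compat; apply exp_pos.
  - left. apply exp_pos.
  - rewrite <- !exp_plus. f_equal. field.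
Qed.

Lemma continuous_on_g3 (a c : R) (I : R -> Prop) :
  0 < a -> (forall x, I x -> 0 < x) -> continuous_on I (g3 a c).
Proof.
  intros Ha HI x Hx.
  apply (filterlim_filter_le_1 (F := locally x)); [apply filter_le_within | ].
  apply (ex_derive_continuous (g3 a c) x).
  eexists. apply (is_derive_ext (fun t => exp (log_g3 a c t))).
  - intros t. symmetry. apply g3_exp.
  - apply (is_derive_comp exp (log_g3 a c)); [apply is_derive_exp | ].
    apply is_derive_log_g3; auto.
Qed.

Lemma g3_elasticity (a c x : R) :
  0 < a -> 0 < x -> x * ((h4 a x - c) / (x + a)) = root_slope a x / x - c * (x / (x + a)).
Proof. intros Ha Hx. rewrite h4_root_slope. field. lra. Qed.

Lemma is_derive_g3_elasticity (a c x : R) :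
  0 < a -> 0 < x ->
  is_derive (fun x => root_slope a x / x - c * (x / (x + a))) x
    (elasticity_slope a x / x ^ 2 - c * (a / (x + a) ^ 2)).
Proof.
  intros Ha Hx.
  apply (is_derive_minus (fun x => root_slope a x * / x) (fun x => c * (x / (x + a)))).
  - replace (elasticity_slope a x / x ^ 2)
      with (x * hurwitz 2 (x + a) * / x + root_slope a x * (- / x ^ 2))
      by (unfold elasticity_slope; field; lra).
    apply (is_derive_prod (root_slope a) (fun x => / x)).
    + apply is_derive_root_slope. lra.
    + auto_derive; [lra | field; lra].
  - auto_derive; [lra | field; lra].
Qed.

Lemma g3_geometrically_convex (a c : R) (I : R -> Prop) :
  0 < a -> c <= 0 -> positive_interval I ->
  (forall x, I x -> 0 <= elasticity_slope a x) -> geometrically_convex_on I (g3 a c).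
Proof.
  intros Ha Hc HI HK. assert (HI' := HI). destruct HI' as [Hpos Hint].
  split; [exact HI | ]. split; [now apply continuous_on_g3 | ].
  split; [intros; rewrite g3_exp; apply exp_pos | ].
  intros x y Hx Hy.
  destruct (log_convex_midpoint I (log_g3 a c) (fun x => (h4 a x - c) / (x + a)))
    with (x := x) (y := y) as [_ H]; try assumption.
  - intros t Ht. apply is_derive_log_g3; auto.
  - intros s t Hs Ht Hst.
    rewrite !g3_elasticity by auto.
    apply (derive_nonneg_le (fun x => root_slope a x / x - c * (x / (x + a)))
      (fun x => elasticity_slope a x / x ^ 2 - c * (a / (x + a) ^ 2))); [exact Hst | | ].
    + intros r Hr. apply is_derive_g3_elasticity; [exact Ha | ].
      apply Hpos, (Hint s t); auto.
    + intros r Hr. assert (Ir : I r) by (apply (Hint s t); auto; lra).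
      assert (Hr0 := Hpos r Ir).
      assert (0 <= elasticity_slope a r / r ^ 2).
      { apply Rdiv_le_0_compat; [now apply HK | now apply pow_lt]. }
      assert (0 < a / (r + a) ^ 2) by (apply Rdiv_lt_0_compat; [ | apply pow_lt]; lra).
      nra.
  - rewrite !g3_exp, <- exp_half_sum. now apply exp_nondecr.
Qed.

Lemma g3_geometrically_concave (a c : R) (I : R -> Prop) :
  0 < a -> 0 <= c -> positive_interval I ->
  (forall x, I x -> elasticity_slope a x <= 0) -> geometrically_concave_on I (g3 a c).
Proof.
  intros Ha Hc HI HK. assert (HI' := HI). destruct HI' as [Hpos Hint].
  split; [exact HI | ]. split; [now apply continuous_on_g3 | ].
  split; [intros; rewrite g3_exp; apply exp_pos | ].
  intros x y Hx Hy.
  destruct (log_convex_midpoint I (fun x => - log_g3 a c x)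
              (fun x => - ((h4 a x - c) / (x + a))))
    with (x := x) (y := y) as [_ H]; try assumption.
  - intros t Ht. apply (is_derive_opp (log_g3 a c)), is_derive_log_g3; auto.
  - intros s t Hs Ht Hst.
    rewrite !Ropp_mult_distr_r_reverse, !g3_elasticity by auto.
    apply (derive_nonneg_le (fun x => - (root_slope a x / x - c * (x / (x + a))))
      (fun x => - (elasticity_slope a x / x ^ 2 - c * (a / (x + a) ^ 2)))); [exact Hst | | ].
    + intros r Hr.
      apply (is_derive_opp (fun x => root_slope a x / x - c * (x / (x + a)))).
      apply is_derive_g3_elasticity; [exact Ha | ]. apply Hpos, (Hint s t); auto.
    + intros r Hr. assert (Ir : I r) by (apply (Hint s t); auto; lra).
      assert (Hr0 := Hpos r Ir).
      assert (0 <= - elasticity_slope a r / r ^ 2).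
      { apply Rdiv_le_0_compat; [specialize (HK r Ir); lra | now apply pow_lt]. }
      replace (- elasticity_slope a r / r ^ 2)
        with (- (elasticity_slope a r / r ^ 2)) in * by (field; lra).
      assert (0 < a / (r + a) ^ 2) by (apply Rdiv_lt_0_compat; [ | apply pow_lt]; lra).
      nra.
  - apply Rle_ge. rewrite !g3_exp, <- exp_half_sum. apply exp_nondecr. lra.
Qed.

(** By the bounds on [hurwitz 2] and [hurwitz 3], with [y = x + a], the bracket
    exceeds [(a - 1 / 2) / y ^ 2] by at least a rational function of order
    [1 / y ^ 3], which is nonnegative when [a] and [y] are at least [1 / 2]. *)
Lemma elasticity_slope'_lower (a x : R) :
  / 2 <= a -> 0 < x ->
  (a - / 2) * x / (x + a) ^ 2
    <= x * (hurwitz 2 (x + a) - 2 * x * hurwitz 3 (x + a)).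
Proof.
  intros Ha Hx.
  assert (H2 := hurwitz2_lower (x + a) ltac:(lra)).
  assert (H3 := hurwitz3_upper (x + a) ltac:(lra)).
  unfold Rdiv. rewrite (Rmult_comm (a - / 2)), !Rmult_assoc.
  apply Rmult_le_compat_l; [lra | ].
  apply (Rmult_le_compat_l x) in H3; [ | lra].
  set (y := x + a) in *.
  assert (Hy : / 2 <= y) by (unfold y; lra).
  apply Rle_trans with
    ((/ y + / (2 * y ^ 2) + / (6 * y ^ 3) - / (30 * y ^ 5))
     - x * (/ y ^ 2 + / y ^ 3 + / (2 * y ^ 4))); [ | lra].
  apply Rminus_le_0.
  replace x with (y - a) by (unfold y; ring).
  replace (_ - (a - / 2) * / y ^ 2)
    with (((a - / 3) * y ^ 2 + (a / 2 * y - / 30)) / y ^ 5) by (field; lra).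
  apply Rdiv_le_0_compat; [ | apply pow_lt; lra].
  apply Rplus_le_le_0_compat; nra.
Qed.

Lemma elasticity_slope_0 (a : R) : elasticity_slope a 0 = ln (Gamma a).
Proof. unfold elasticity_slope. rewrite root_slope_0. ring. Qed.

Lemma elasticity_slope_nondecr (a x y : R) :
  / 2 <= a -> 0 <= x <= y -> elasticity_slope a x <= elasticity_slope a y.
Proof.
  intros Ha Hxy.
  apply (derive_nonneg_le (elasticity_slope a)
    (fun x => x * (hurwitz 2 (x + a) - 2 * x * hurwitz 3 (x + a)))); [lra | | ].
  - intros t Ht. apply is_derive_elasticity_slope. lra.
  - intros t Ht.
    apply Rle_trans with (2 := elasticity_slope'_lower a t Ha ltac:(lra)).
    apply Rdiv_le_0_compat; [nra | apply pow_lt; lra].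
Qed.

Lemma elasticity_slope_zero (a : R) :
  1 < a < 2 -> exists z, 0 < z /\ elasticity_slope a z = 0.
Proof.
  intros Ha.
  destruct (log_growth_unbounded (elasticity_slope a)
    (fun x => x * (hurwitz 2 (x + a) - 2 * x * hurwitz 3 (x + a)))
    a (a - / 2) 0) as [X [HX Hbig]]; [lra | lra | | | ].
  - intros t Ht. apply is_derive_elasticity_slope. lra.
  - intros t Ht. apply elasticity_slope'_lower; lra.
  - destruct (intermediate_zero (elasticity_slope a)
      (fun x => x * (hurwitz 2 (x + a) - 2 * x * hurwitz 3 (x + a))) 0 X)
      as [z [Hz Ez]]; [exact HX | | | | ].
    + intros t Ht. apply is_derive_elasticity_slope. lra.
    + rewrite elasticity_slope_0. now apply log_Gamma_neg.
    + apply Hbig. lra.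
    + exists z. split; [lra | exact Ez].
Qed.

Theorem theorem3 (a : R) (ha : 0 < a) :
  (* (1) (i) *)
  (2 <= a -> forall c : R,
     strictly_decreasing_on positive_half_line (g3 a c) <-> 1 <= c) /\
  (* (1) (ii) *)
  (a = 2 -> forall c : R,
     strictly_increasing_on positive_half_line (g3 a c) <->
     c <= PI ^ 2 / 6 - 1) /\
  (* (1) (iii) *)
  ((3 + sqrt 159) / 12 <= a < 2 ->
     exists x4 : R,
       0 < x4 /\
       x4 ^ 2 * (x4 + a) * trigamma (x4 + a)
         + (x4 + 2 * a) * ln (Gamma (x4 + a))
         = x4 * (x4 + 2 * a) * digamma (x4 + a) /\
       forall c : R,
         strictly_increasing_on positive_half_line (g3 a c) <->
         c <= h4 a x4) /\
  (* (2), first part *)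
  (1 / 2 <= a <= 1 \/ 2 <= a -> forall c : R, c <= 0 ->
     geometrically_convex_on positive_half_line (g3 a c)) /\
  (* (2), second part *)
  (1 < a < 2 ->
     exists x3 : R,
       0 < x3 /\
       x3 ^ 2 * trigamma (x3 + a) + ln (Gamma (x3 + a))
         = x3 * digamma (x3 + a) /\
       (forall c : R, 0 <= c ->
          geometrically_concave_on (fun x : R => 0 < x < x3) (g3 a c)) /\
       (forall c : R, c <= 0 ->
          geometrically_convex_on (fun x : R => x3 < x) (g3 a c))).
Proof.
  refine (conj _ (conj _ (conj _ (conj _ _)))).
  - intros Ha c. split.
    + intros Hdecr. apply (one_le_h4_upper_bound a c ha).
      now apply h4_upper_of_g3_decr.
    + intros Hc x y Hx Hy Hxy. unfold positive_half_line in *.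
      apply g3_gt; [exact ha | lra | ].
      intros t Ht. assert (H := h4_lt_1 a t Ha ltac:(lra)). lra.
  - intros -> c. rewrite <- hurwitz_2_2. split.
    + intros Hincr. apply h4_2_lower_bounds. now apply h4_lower_of_g3_incr.
    + intros Hc x y Hx Hy Hxy. unfold positive_half_line in *.
      apply g3_lt; [lra | lra | ].
      intros t Ht.
      assert (H1 := proj2 (h4_2_lower_bounds c) Hc x Hx).
      assert (H2 := h4_2_incr x t ltac:(lra)). lra.
  - intros Ha.
    (* [159 > (126 / 10) ^ 2], whence [13 / 10 <= a] *)
    assert (Hs : 126 / 10 <= sqrt 159).
    { rewrite <- (sqrt_square (126 / 10)) by lra. apply sqrt_le_1_alt. lra. }
    destruct (h4_minimum a ltac:(lra)) as (z & Hz & Ez & Hmin).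
    exists z. split; [exact Hz | ]. split.
    + rewrite trigamma_eq_hurwitz by lra.
      unfold h4_slope, root_slope in Ez. lra.
    + intros c. split.
      * intros Hincr. now apply h4_lower_of_g3_incr.
      * intros Hc x y Hx Hy Hxy. unfold positive_half_line in *.
        (* [h4 a] may equal [c] at [z], so the half-line is cut there *)
        assert (Hoff : forall u v, 0 < u < v -> v <= z \/ z <= u -> g3 a c u < g3 a c v).
        { intros u v Huv Hside. apply g3_lt; [exact ha | lra | ].
          intros t Ht. assert (H := Hmin t ltac:(lra) ltac:(lra)). lra. }
        destruct (Rle_dec y z) as [H1 | H1]; [apply Hoff; lra | ].
        destruct (Rle_dec z x) as [H2 | H2]; [apply Hoff; lra | ].
        apply Rlt_trans with (g3 a c z); apply Hoff; lra.
  - intros Ha c Hc. apply g3_geometrically_convex; [exact ha | exact Hc | | ].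
    + unfold positive_half_line. split; intros; lra.
    + intros x Hx. unfold positive_half_line in Hx.
      apply Rle_trans with (elasticity_slope a 0).
      * rewrite elasticity_slope_0. apply log_Gamma_nonneg; lra.
      * apply elasticity_slope_nondecr; lra.
  - intros Ha. destruct (elasticity_slope_zero a Ha) as (z & Hz & Ez).
    exists z. split; [exact Hz | ]. split; [ | split].
    + rewrite trigamma_eq_hurwitz by lra.
      unfold elasticity_slope, root_slope in Ez. lra.
    + intros c Hc. apply g3_geometrically_concave; [exact ha | exact Hc | | ].
      * split; intros; lra.
      * intros x Hx. rewrite <- Ez. apply elasticity_slope_nondecr; lra.
    + intros c Hc. apply g3_geometrically_convex; [exact ha | exact Hc | | ].
      * split; intros; lra.
      * intros x Hx. rewrite <- Ez. apply elasticity_slope_nondecr; lra.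
Qed.
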